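(* Assume Assumptions A1 and A2$'$. Let $\mathcal H_{\mathrm{lin}}=\{\hat\theta=A(X)y:A(X)\in\mathbb R^{d\times n}\}$ and $\mathcal H_{\mathrm{sq}}=\{\hat\theta \text{ measurable}:\mathbb E_y[\|\hat\theta(X,y)\|_2^2\mid X]<\infty\}$. Then (conditionally on $X$) for all $\epsilon\ge0$, $$\inf_{\hat\theta\in\mathcal H_{\mathrm{sq}}(\epsilon)}\mathrm{Pred}_X(\hat\theta)=\min_{\hat\theta\in\mathcal H_{\mathrm{lin}}(\epsilon)}\mathrm{Pred}_X(\hat\theta).$$
   Context: Setup: $y=X\theta+w$ with $X\in\mathbb R^{n\times d}$, $d\ge n$. Assumption A1: $d/n\to\gamma\in(1,\infty)$; $X=Z\Sigma^{1/2}$, $\Sigma$ deterministic symmetric positive definite, $Z$ with i.i.d. mean-$0$ variance-$1$ entries with bounded fourth moment; $\theta$ independent of $X,w$. Assumption A2$'$: $\theta\sim\mathsf N(0,I_d/d)$, $w\sim\mathsf N(0,\sigma^2I_n)$ with $\sigma>0$, independent of each other and of $X$. For an estimator $\hat\theta=\hat\theta(X,y)$: $\mathrm{Train}_X(\hat\theta)=\frac1n\mathbb E[\|X\hat\theta-y\|_2^2\mid X]$, $\mathrm{Pred}_X(\hat\theta)=\mathbb E[\|\Sigma^{1/2}(\hat\theta-\theta)\|_2^2\mid X]$ (expectations over $\theta,w$). For a class $\mathcal H$, $\mathcal H(\epsilon):=\{\hat\theta\in\mathcal H:\mathrm{Train}_X(\hat\theta)\ge\epsilon^2\}$. *)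

(* Defs.v *)
From HB Require Import structures.
From mathcomp Require Import all_boot all_order all_algebra.
From mathcomp Require Import all_classical all_reals all_analysis.
Set Implicit Arguments. Unset Strict Implicit. Unset Printing Implicit Defensive.
Import Order.TTheory GRing.Theory Num.Theory.
Local Open Scope classical_set_scope.
Local Open Scope ring_scope.

Section Defs.
Context {R : realType}.

Definition sqnorm (m : nat) (v : 'cV[R]_m) : R := \sum_(i < m) v i 0 ^+ 2.

(* weighted squared norm ||Sigma^{1/2} v||^2 = v^T Sigma v *)
Definition sqnormS (m : nat) (S : 'M[R]_m) (v : 'cV[R]_m) : R :=
  \sum_(i < m) \sum_(j < m) v i 0 * S i j * v j 0.

Definition spd (m : nat) (S : 'M[R]_m) : Prop :=
  S^T = S /\ forall v : 'cV[R]_m, v != 0 -> 0 < sqnormS S v.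

Definition borel_cV (m : nat) : set (set 'cV[R]_m) :=
  <<s [set A | exists B : 'I_m -> set R,
          (forall j, measurable (B j)) /\ A = [set v : 'cV[R]_m | forall j, B j (v j 0)]] >>.

Definition borel_map (n d : nat) (f : 'cV[R]_n -> 'cV[R]_d) : Prop :=
  forall (k : 'I_d) (B : set R), measurable B ->
    borel_cV [set v | B (f v k 0)].

(* Assumption A2': on the probability space (T,P), the coordinates of
   theta are i.i.d. N(0,1/d), those of w are i.i.d. N(0,sigma^2), all
   mutually independent (joint law given on boxes). *)
Definition gaussian_model (dT : measure_display) (T : measurableType dT)
  (P : probability T R) (n d : nat) (sigma : R)
  (theta : 'I_d -> T -> R) (w : 'I_n -> T -> R) : Prop :=
  (forall i, measurable_fun setT (theta i)) /\
  (forall j, measurable_fun setT (w j)) /\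
  forall (A : 'I_d -> set R) (B : 'I_n -> set R),
    (forall i, measurable (A i)) -> (forall j, measurable (B j)) ->
    P ([set t | forall i, A i (theta i t)] `&` [set t | forall j, B j (w j t)])
    = ((\prod_(i < d) normal_prob 0 (Num.sqrt (d%:R^-1)) (A i)) *
       (\prod_(j < n) normal_prob 0 sigma (B j)))%E.

Section Model.
Variables (dT : measure_display) (T : measurableType dT) (P : probability T R).
Variables (n d : nat) (X : 'M[R]_(n, d)) (Sigma : 'M[R]_d).
Variables (theta : 'I_d -> T -> R) (w : 'I_n -> T -> R).

Definition thetaV (t : T) : 'cV[R]_d := \col_i theta i t.
Definition wV (t : T) : 'cV[R]_n := \col_j w j t.
Definition yV (t : T) : 'cV[R]_n := X *m thetaV t + wV t.

(* expectation over (theta, w), X fixed (conditioning on X) *)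
Definition Ex (g : T -> R) : \bar R := (\int[P]_t (g t)%:E)%E.

Definition Train (est : 'cV[R]_n -> 'cV[R]_d) : \bar R :=
  ((n%:R^-1)%:E * Ex (fun t => sqnorm (X *m est (yV t) - yV t)))%E.

Definition Pred (est : 'cV[R]_n -> 'cV[R]_d) : \bar R :=
  Ex (fun t => sqnormS Sigma (est (yV t) - thetaV t)).

Definition H_sq : set ('cV[R]_n -> 'cV[R]_d) :=
  [set est | borel_map est /\ (Ex (fun t => sqnorm (est (yV t))) < +oo)%E].

Definition lin_est (A : 'M[R]_(d, n)) : 'cV[R]_n -> 'cV[R]_d := fun y => A *m y.

Definition restrict_train (H : set ('cV[R]_n -> 'cV[R]_d)) (eps : R) :=
  [set est | H est /\ ((eps ^+ 2)%:E <= Train est)%E].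

End Model.
End Defs.

(* Main.v *)
(** With [A0] the Bayes (posterior mean) matrix, [A0 y - theta] is orthogonal to
    every square-integrable function of [y], so for an estimator [f] and
    [delta := f(y) - A0 y] the prediction risk is [E|delta|^2] in the
    [Sigma]-norm plus a constant, while the training error is
    [E|X delta - K y|^2 / n] with [K := 1 - X A0].  Project [delta] on the linear
    functions of [y], [delta = A1 y + r] with [r] orthogonal to [y], and let [v]
    be a top eigenvector of [X^T X] relative to [Sigma].  Spend all the
    [Sigma]-energy of [r] and of the [v]-component of [A1 y] on a single term
    [- c v (u y)], where [u := v^T X^T K].  The prediction risk is unchanged; the
    training error does not decrease, because [v] maximizes the Rayleigh quotient
    and, by Cauchy-Schwarz, no other [v]-component of the same energy correlates
    more negatively with [u y].  Existence of a best linear estimator is a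
    compactness argument.

    The orthogonality is derived from the Cameron-Martin formula: shifting
    [(theta, w)] by [(p, - X p)] leaves [y] unchanged and multiplies the law by
    an explicit exponential density. *)
Require Import Defs.
From HB Require Import structures.
From mathcomp Require Import all_boot all_order all_algebra.
From mathcomp Require Import all_classical all_reals all_analysis.
From mathcomp Require Import measurable_realfun normal_distribution ring lra.
Import Order.TTheory GRing.Theory Num.Theory.
Import numFieldNormedType.Exports.
Local Open Scope classical_set_scope.
Local Open Scope ring_scope.
Set Implicit Arguments.
Unset Strict Implicit.
Unset Printing Implicit Defensive.

(** * Change of measure *)

Section density.
Context {d1 d2 d3 : measure_display} {T1 : measurableType d1}.
Context {T2 : measurableType d2} {S : measurableType d3} {R : realType}.
Context (P1 : {measure set T1 -> \bar R}) (P2 : {measure set T2 -> \bar R}).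
Context (Y1 : T1 -> S) (Y2 : T2 -> S) (D : T2 -> R).
Hypotheses (mY1 : measurable_fun setT Y1) (mY2 : measurable_fun setT Y2).
Hypotheses (mD : measurable_fun setT D) (D0 : forall t, 0 <= D t).
Hypothesis H : forall A, measurable A ->
  P1 (Y1 @^-1` A) = (\int[P2]_(t in Y2 @^-1` A) (D t)%:E)%E.
Import HBNNSimple.

(** The hypothesis [H] identifies the law of [Y1] under [P1] with that of [Y2] under the measure of
    density [D] with respect to [P2]; for a simple function this is applied on each level set. *)
Lemma integral_reweight_nnsfun (f : {nnsfun S >-> R}) :
  (\int[P1]_t (f (Y1 t))%:E = \int[P2]_t (f (Y2 t) * D t)%:E)%E.
Proof.
have mp d (T : measurableType d) (Y : T -> S) (mY : measurable_fun setT Y) r :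
    measurable (Y @^-1` (f @^-1` [set r])).
  rewrite -[X in measurable X]setTI; exact: mY.
have mi d (T : measurableType d) (Y : T -> S) (mY : measurable_fun setT Y) r :
    measurable_fun setT (\1_(Y @^-1` (f @^-1` [set r])) : T -> R).
  exact/measurable_indic/mp.
transitivity (\sum_(k \in range f)
    \int[P1]_t (k * \1_(Y1 @^-1` (f @^-1` [set k])) t)%:E)%E.
  rewrite -ge0_integral_fsum//.
  - apply: eq_integral => t _.
    by rewrite fimfunE -fsumEFin.
  - by move=> r; apply/measurable_EFinP/measurable_funM => //; exact: mi.
  - move=> r t _.  exact: nnfun_muleindic_ge0.
transitivity (\sum_(k \in range f)
    \int[P2]_t (k * \1_(Y2 @^-1` (f @^-1` [set k])) t * D t)%:E)%E; last first.
  rewrite -ge0_integral_fsum//.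
  - apply: eq_integral => t _.
    rewrite EFinM fimfunE -fsumEFin// ge0_mule_fsuml//.
    by move=> r; exact: nnfun_muleindic_ge0.
  - move=> r; apply/measurable_EFinP/measurable_funM => //.
    by apply/measurable_funM => //; exact: mi.
  - move=> r t _; rewrite EFinM mule_ge0 ?lee_fin//.
    exact: nnfun_muleindic_ge0.
apply: eq_fsbigr => r /[!inE] -[s _ fs].
have r0 : 0 <= r by rewrite -fs.
under eq_integral do rewrite EFinM.
under [RHS]eq_integral do rewrite -mulrA EFinM.
rewrite ge0_integralZl//; last exact/measurable_EFinP/mi.
rewrite ge0_integralZl//; last 2 first.
    by apply/measurable_EFinP/measurable_funM => //; exact: mi.
  by move=> t _; rewrite lee_fin mulr_ge0.
congr (_ * _)%E; rewrite integral_indic//; last exact: mp.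
rewrite setIT H//.
rewrite [LHS]integral_mkcond; apply: eq_integral => t _.
by rewrite patchE indicE; case: ifP => _; rewrite ?mul1r ?mul0r.
Qed.

(** Monotone convergence along simple approximations of [h]; the weighted sequence stays increasing
    because [D] is nonnegative. *)
Lemma integral_reweight (h : S -> R) : measurable_fun setT h ->
  (forall s, 0 <= h s) ->
  (\int[P1]_t (h (Y1 t))%:E = \int[P2]_t (h (Y2 t) * D t)%:E)%E.
Proof.
move=> mh h0.
have meh : measurable_fun setT (EFin \o h) by exact/measurable_EFinP.
pose f_ := nnsfun_approx measurableT meh.
have cef s : (EFin \o f_ ^~ s) @ \oo --> (h s)%:E.
  by apply: (cvg_nnsfun_approx measurableT meh) => // ? _; rewrite lee_fin.
have cf s : f_ ^~ s @ \oo --> h s by have /fine_cvgP[] := cef s.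
transitivity (limn (fun n => \int[P1]_t (f_ n (Y1 t))%:E)%E).
  rewrite -monotone_convergence//.
  - by apply: eq_integral => t _; apply/esym/cvg_lim => //; exact: cef.
  - by move=> n; apply/measurable_EFinP/(measurableT_comp _ mY1).
  - by move=> n t _; rewrite lee_fin.
  - by move=> t _ m n mn; rewrite lee_fin; exact/lefP/nd_nnsfun_approx.
transitivity (limn (fun n => \int[P2]_t (f_ n (Y2 t) * D t)%:E)%E).
  by apply: congr_lim; apply/funext => n; exact: integral_reweight_nnsfun.
rewrite -monotone_convergence//.
- apply: eq_integral => t _; apply/cvg_lim => //.
  apply: cvg_EFin; first exact: nearW.
  by apply: cvgMl; exact: cf.
- move=> n; apply/measurable_EFinP/measurable_funM => //.
  exact: (measurableT_comp _ mY2).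
- by move=> n t _; rewrite lee_fin mulr_ge0.
- move=> t _ m n mn; rewrite lee_fin ler_wpM2r//.
  exact/lefP/nd_nnsfun_approx.
Qed.

End density.

(** * Translations of Lebesgue measure and of normal laws *)

Section translation.
Context {R : realType}.

Lemma measurable_preimageT d1 d2 (T1 : measurableType d1)
  (T2 : measurableType d2) (f : T1 -> T2) (B : set T2) :
  measurable_fun setT f -> measurable B -> measurable (f @^-1` B).
Proof. by move=> mf mB; rewrite -[X in measurable X]setTI; exact: mf. Qed.

Lemma measurable_translation (a : R) : measurable_fun setT (fun x : R => x + a).
Proof. exact: measurable_funD. Qed.

(** The translated measure still gives half-open intervals their length, which characterizes
    Lebesgue measure. *)
Lemma lebesgue_measure_translation (a : R) (A : set R) : measurable A ->
  lebesgue_measure ((fun x => x + a) @^-1` A) = lebesgue_measure A.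
Proof.
move=> mA; apply/esym.
have mf : measurable_fun setT ((fun x => x + a) : _ -> measurableTypeR R).
  exact: measurable_translation.
rewrite -[RHS]/(pushforward lebesgue_measure
  ((fun x => x + a) : _ -> measurableTypeR R) A).
apply: lebesgue_measure_unique => //= _ [[b c]] _ <-.
rewrite /pushforward.
have -> : (fun x => x + a) @^-1` `]b, c] = `]b - a, c - a]%classic.
  by apply/seteqP; split=> x /=; rewrite !in_itv/= ltrBlDr lerBrDr.
rewrite !lebesgue_measure_itv/= !lte_fin ltrD2r.
by case: ifP => // _; rewrite -!EFinB; congr EFin; ring.
Qed.

(** Cameron-Martin in dimension one: completing the square shows that the exponential is the ratio
    of the densities of N(a, s^2) and N(0, s^2). *)
Lemma normal_prob_shift (a s : R) (A : set R) : s != 0 -> measurable A ->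
  normal_prob 0 s ((fun x => x + a) @^-1` A) =
  (\int[normal_prob 0 s]_(x in A)
    (expR (a * x / s ^+ 2 - a ^+ 2 / (s ^+ 2 *+ 2)))%:E)%E.
Proof.
move=> s0 mA.
have mpre : measurable ((fun x => x + a) @^-1` A).
  exact: measurable_preimageT (measurable_translation a) mA.
have tilt x : expR (a * x / s ^+ 2 - a ^+ 2 / (s ^+ 2 *+ 2)) *
    normal_pdf 0 s x = normal_pdf a s x.
  rewrite !normal_pdfE// mulrCA; congr (_ * _).
  rewrite /normal_fun -expRD; congr expR.
  by rewrite subr0 -mulr_natr; field.
pose w x := \1_A x * expR (a * x / s ^+ 2 - a ^+ 2 / (s ^+ 2 *+ 2)).
have mw : measurable_fun setT w.
  apply: measurable_funM; first exact: measurable_indic.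
  apply: measurableT_comp => //; apply: measurable_funB => //.
  by apply: measurable_funM => //; exact: measurable_funM.
have w0 x : 0 <= w x by rewrite mulr_ge0 ?expR_ge0.
have mi : measurable_fun setT (fun x => \1_A x * normal_pdf a s x).
  apply: measurable_funM; first exact: measurable_indic.
  exact: measurable_normal_pdf.
(* Both sides equal the integral of [normal_pdf a s] over [A]: the left one by translation
   invariance, the right one by [tilt]. *)
transitivity (\int[lebesgue_measure]_x (\1_A x * normal_pdf a s x)%:E)%E.
  rewrite (@integral_reweight _ _ _ _ _ _ R lebesgue_measure lebesgue_measure
    idfun (fun x => x + a) (fun=> 1) _ _ _ _ _
    (fun x => \1_A x * normal_pdf a s x))//.
  - rewrite /normal_prob [LHS]integral_mkcond; apply: eq_integral => x _.
    rewrite patchE mulr1 !normal_pdfE// /normal_fun addrK subr0 indicE.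
    have -> : (x \in (fun x => x + a) @^-1` A) = (x + a \in A).
      by apply/idP/idP => /set_mem ?; apply/mem_set.
    by case: ifP => _; rewrite ?mul1r ?mul0r.
  - exact: measurable_id.
  - exact: measurable_translation.
  - move=> B mB; rewrite integral_cst ?mul1e; last first.
      exact: measurable_preimageT (measurable_translation a) mB.
    exact/esym/lebesgue_measure_translation.
  - by move=> x; rewrite mulr_ge0 ?normal_pdf_ge0.
transitivity (\int[normal_prob 0 s]_x (w x)%:E)%E; last first.
  rewrite [RHS]integral_mkcond; apply: eq_integral => x _.
  by rewrite patchE /w indicE; case: ifP => _; rewrite ?mul1r ?mul0r.
apply/esym; transitivity (\int[lebesgue_measure]_x
    (w x * normal_pdf 0 s x)%:E)%E; last first.
  by apply: eq_integral => x _; rewrite /w -tilt mulrA.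
apply: (@integral_reweight _ _ _ _ _ _ R (normal_prob 0 s) lebesgue_measure
  idfun idfun (normal_pdf 0 s)).
- exact: measurable_id.
- exact: measurable_id.
- exact: measurable_normal_pdf.
- exact: normal_pdf_ge0.
- by move=> B mB.
- exact: mw.
- exact: w0.
Qed.

End translation.

(** * The Cameron-Martin formula *)

Definition boxes (R : realType) (m : nat) : set (set 'cV[R]_m) :=
  [set A | exists B : 'I_m -> set R, (forall j, measurable (B j)) /\
     A = [set v : 'cV[R]_m | forall j, B j (v j 0)]].

Arguments boxes : clear implicits.

(* [borel_cV m] is by definition the sigma-algebra of this type. *)
Definition cylT (R : realType) (m : nat) := g_sigma_algebraType (boxes R m).

Section cylinder.
Context {R : realType}.

Lemma setI_closed_boxes m : setI_closed (boxes R m).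
Proof.
move=> _ _ [A [mA ->]] [B [mB ->]]; exists (fun j => A j `&` B j); split.
  by move=> j; exact: measurableI.
apply/seteqP; split=> [v [Av Bv] j|v ABv]; first by split.
by split=> j; have [] := ABv j.
Qed.

Lemma measurable_forall d (T : measurableType d) m (A : 'I_m -> set T) :
  (forall j, measurable (A j)) -> measurable [set t | forall j, A j t].
Proof.
move=> mA.
rewrite [X in measurable X](_ : _ = \bigcap_(j in [set: 'I_m]) A j).
  by apply: fin_bigcap_measurable => // j _; exact: mA.
by apply/seteqP; split=> t At j; [move=> _|]; exact: At.
Qed.

Lemma measurable_fun_cylT d (T : measurableType d) m (f : T -> 'cV[R]_m) :
  (forall j, measurable_fun setT (fun t => f t j 0)) ->
  measurable_fun setT (f : T -> cylT R m).
Proof.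
move=> mf; apply: (@measurability _ _ T (cylT R m) setT f (boxes R m)) => //.
move=> _ [_ [B [mB ->]] <-]; rewrite setTI.
apply: (@measurable_forall _ _ _ (fun j => (fun t => f t j 0) @^-1` B j)) => j.
exact: measurable_preimageT.
Qed.

Lemma measurable_fun_coord m (j : 'I_m) :
  measurable_fun setT (fun v : cylT R m => (v : 'cV[R]_m) j 0).
Proof.
move=> _ B mB; rewrite setTI; apply: sub_sigma_algebra.
exists (fun i => if i == j then B else setT); split.
  by move=> i; case: ifP.
apply/seteqP; split=> [v Bv i|v /(_ j)]; last by rewrite eqxx.
by case: eqP => // ->.
Qed.

Lemma measurable_fun_addC m (a : 'cV[R]_m) :
  measurable_fun setT (fun v : cylT R m => ((v : 'cV[R]_m) + a) : cylT R m).
Proof.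
apply: measurable_fun_cylT => j.
under eq_fun do rewrite mxE.
by apply: measurable_funD => //; exact: measurable_fun_coord.
Qed.

Lemma measurable_fun_mulmx d (T : measurableType d) m p (B : 'M[R]_(p, m))
    (f : T -> 'cV[R]_m) :
  (forall j, measurable_fun setT (fun t => f t j 0)) ->
  forall i, measurable_fun setT (fun t => (B *m f t) i 0).
Proof.
move=> mf i; under eq_fun do rewrite mxE.
by apply: measurable_sum => j; exact: measurable_funM.
Qed.

End cylinder.

Section cameron_martin.
Context {R : realType} {dT : measure_display} {T : measurableType dT}.
Context (P : probability T R) {N : nat} (xi : T -> 'cV[R]_N) (s : 'I_N -> R).
Hypothesis mxi : forall k, measurable_fun setT (fun t => xi t k 0).
Hypothesis s0 : forall k, s k != 0.
Hypothesis xi_law : forall A : 'I_N -> set R, (forall k, measurable (A k)) ->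
  P [set t | forall k, A k (xi t k 0)] =
  (\prod_(k < N) normal_prob 0 (s k) (A k))%E.

Let tilt (k : 'I_N) (c x : R) :=
  expR (c * x / s k ^+ 2 - c ^+ 2 / (s k ^+ 2 *+ 2)).

Let mtilt k c : measurable_fun setT (tilt k c).
Proof.
apply: measurableT_comp => //; apply: measurable_funB => //.
by apply: measurable_funM => //; exact: measurable_funM.
Qed.

Let mxiC : measurable_fun setT (xi : T -> cylT R N).
Proof. exact: measurable_fun_cylT. Qed.

(** By independence, a shift along one coordinate changes only the [k]-th factor of the product law,
    where the one-dimensional formula applies. *)
Lemma box_shift_coord (k : 'I_N) (c : R) (A : set 'cV[R]_N) : boxes R N A ->
  P [set t | A (xi t + c *: delta_mx k 0)] =
  (\int[P]_(t in xi @^-1` A) (tilt k c (xi t k 0))%:E)%E.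
Proof.
move=> [B [mB ->]].
pose C j := if j == k then (fun x => x + c) @^-1` B j else B j.
have mC j : measurable (C j).
  by rewrite /C; case: ifP => // _; exact: measurable_preimageT (measurable_translation c) _.
rewrite [X in P X](_ : _ = [set t | forall j, C j (xi t j 0)]); last first.
  apply/seteqP; split=> t /= Bt j; have := Bt j; rewrite /C !mxE eqxx andbT;
    by case: eqP => [->|]; rewrite ?mulr1 ?mulr0 ?addr0.
rewrite xi_law// (bigD1 k)//=.
have -> : C k = (fun x => x + c) @^-1` B k by rewrite /C eqxx.
rewrite normal_prob_shift//.
under eq_bigr => j /negPf jk do rewrite /C jk.
set p := (\prod_(j < N | _) _)%E.
have p0 : (0 <= p)%E by apply: prode_ge0 => j _; exact: measure_ge0.
have pfin : p \is a fin_num.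
  by apply: prode_fin_num => j _; apply: fin_num_measure; exact: mB.
have q0 : (0 <= fine p)%R by exact: fine_ge0.
(* The box with its [k]-th side opened to the whole line; it keeps the constraints on the other
   coordinates and has probability [p]. *)
pose E := [set t | forall j, (if j == k then setT else B j) (xi t j 0)].
have mE : measurable E.
  apply: (@measurable_forall _ _ _ (fun j => (fun t => xi t j 0) @^-1`
    (if j == k then setT else B j))) => j.
  by apply: measurable_preimageT => //; case: ifP.
pose h x := \1_(B k) x * tilt k c x.
have mh : measurable_fun setT h.
  by apply: measurable_funM => //; exact: measurable_indic.
have h0 x : 0 <= h x by rewrite mulr_ge0 ?expR_ge0.
(* Independence read as a reweighting: restricted to [E], the [k]-th coordinate has [p] times its
   normal law. *)
have := @integral_reweight _ _ _ _ _ _ R (mscale (NngNum q0) (normal_prob 0 (s k)))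
  P idfun (fun t => xi t k 0) \1_E _ _ _ _ _ h mh h0.
rewrite ge0_integral_mscale//; last 2 first.
- exact/measurable_EFinP.
- by move=> x _; rewrite lee_fin.
rewrite /= fineK// muleC => H.
transitivity ((\int[normal_prob 0 (s k)]_x (h x)%:E) * p)%E.
  congr (_ * _)%E; rewrite [LHS]integral_mkcond; apply: eq_integral => x _.
  by rewrite patchE /h indicE; case: ifP => _; rewrite ?mul1r ?mul0r.
rewrite H; last 5 first.
- exact: measurable_id.
- exact: mxi.
- exact: measurable_indic.
- by move=> t.
- move=> D mD.
  rewrite integral_indic//; last exact: measurable_preimageT (mxi k) mD.
  rewrite /mscale/= fineK//.
  rewrite [X in P X](_ : _ = [set t | forall j,
    (if j == k then D else B j) (xi t j 0)]); last first.
    apply/seteqP; split=> [t [Et Dt] j|t Et]; last split.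
    - by have := Et j; case: eqP => // ->.
    - by move=> j; have := Et j; case: eqP.
    - by have := Et k; rewrite eqxx.
  rewrite (@xi_law (fun j => if j == k then D else B j)); last first.
    by move=> j; case: ifP.
  rewrite (bigD1 k)//= eqxx muleC; congr (_ * _)%E.
  by apply: eq_bigr => j /negPf ->.
rewrite [RHS]integral_mkcond; apply: eq_integral => t _.
rewrite patchE /h mulrAC !indicE.
have -> : (t \in xi @^-1` [set v | forall j, B j (v j 0)]) =
    (xi t k 0 \in B k) && (t \in E).
  apply/idP/andP => [/set_mem Bt|[/set_mem Bt /set_mem Et]].
    by split; apply/mem_set => // j; case: ifP.
  by apply/mem_set => j; have := Et j; case: eqP => // ->.
by case: (_ \in _); case: (_ \in _); rewrite /= ?mul1r ?mul0r.
Qed.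

(** Boxes are a generating pi-system, so Dynkin induction extends the identity on boxes to all
    measurable sets; reweighting then passes to functions. *)
Lemma cameron_martin_coord (k : 'I_N) (c : R) (h : cylT R N -> R) :
  measurable_fun setT h -> (forall v, 0 <= h v) ->
  (\int[P]_t (h (xi t + c *: delta_mx k 0))%:E =
   \int[P]_t (h (xi t) * tilt k c (xi t k 0))%:E)%E.
Proof.
move=> mh h0.
have mY1 : measurable_fun setT
    ((fun t => xi t + c *: delta_mx k 0) : T -> cylT R N).
  exact: measurableT_comp (measurable_fun_addC _) mxiC.
have mD : measurable_fun setT (fun t => tilt k c (xi t k 0)).
  exact: measurableT_comp (mtilt k c) (mxi k).
apply: (@integral_reweight _ _ _ _ _ _ R P P
  ((fun t => xi t + c *: delta_mx k 0) : T -> cylT R N) xi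
  (fun t => tilt k c (xi t k 0))) => //; first by move=> t; exact: expR_ge0.
have mDE A : measurable A -> measurable_fun A
   (fun t => (tilt k c (xi t k 0))%:E).
  by move=> mA; apply/measurable_EFinP/measurable_funTS.
have D0 t : (0 <= (tilt k c (xi t k 0))%:E)%E by rewrite lee_fin expR_ge0.
have boxT : boxes R N setT by exists (fun=> setT); split=> //; apply/seteqP.
(* The full box shows that the tilted measure has total mass one, as the complement step of the
   induction requires. *)
have totD : (\int[P]_t (tilt k c (xi t k 0))%:E = 1)%E.
  by have := box_shift_coord k c boxT; rewrite preimage_setT => <-; exact: probability_setT.
apply: (@dynkin_induction _ (cylT R N) (boxes R N)) => //.
- exact: setI_closed_boxes.
- by rewrite [RHS]totD; exact: probability_setT.
- exact: box_shift_coord.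
- move=> A mA HA.
  have mA1 := measurable_preimageT mY1 mA.
  have mA2 := measurable_preimageT mxiC mA.
  have fA : (\int[P]_(t in xi @^-1` A) (tilt k c (xi t k 0))%:E)%E \is a fin_num.
    by rewrite -HA; exact: fin_num_measure.
  have split1 : ((\int[P]_(t in xi @^-1` A) (tilt k c (xi t k 0))%:E) +
      \int[P]_(t in ~` (xi @^-1` A)) (tilt k c (xi t k 0))%:E = 1)%E.
    rewrite -ge0_integral_setU//.
    + by rewrite setUv.
    + exact: measurableC.
    + by rewrite setUv; exact: mDE.
    + exact/disj_setPRL.
  have PC := probability_setC P mA1.
  rewrite [LHS]PC HA -split1 addeAC subee// add0e.
  by rewrite preimage_setC.
- move=> F mF tF HF.
  have tpre (Y : T -> cylT R N) : trivIset setT (fun n => Y @^-1` F n).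
    apply/trivIsetP => i j _ _ ij; rewrite -preimage_setI.
    by move/trivIsetP : tF => /(_ i j Logic.I Logic.I ij) ->; rewrite preimage_set0.
  rewrite !preimage_bigcup ge0_integral_bigcup//; last 2 first.
  + by move=> n; exact: measurable_preimageT.
  + by apply: mDE; apply: bigcupT_measurable => n; exact: measurable_preimageT.
  rewrite measure_bigcup//; last by move=> n _; exact: measurable_preimageT.
  apply/congr_lim/funext => n; apply: eq_big => i; first by rewrite in_setT.
  by move=> _; exact: HF.
Qed.

(** The coordinates are shifted one at a time, and the exponential factors multiply. *)
Lemma cameron_martin (a : 'cV[R]_N) (h : cylT R N -> R) :
  measurable_fun setT h -> (forall v, 0 <= h v) ->
  (\int[P]_t (h (xi t + a))%:E =
   \int[P]_t (h (xi t) * expR (\sum_(k < N)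
     (a k 0 * xi t k 0 / s k ^+ 2 - a k 0 ^+ 2 / (s k ^+ 2 *+ 2))))%:E)%E.
Proof.
move=> mh h0.
(* The induction quantifies over all functions [g], because each step multiplies [g] by a tilt. *)
suff key r : uniq r -> forall g : cylT R N -> R,
    measurable_fun setT g -> (forall v, 0 <= g v) ->
  (\int[P]_t (g (xi t + \sum_(k <- r) a k 0 *: delta_mx k 0))%:E =
   \int[P]_t (g (xi t) * \prod_(k <- r) tilt k (a k 0) (xi t k 0))%:E)%E.
  have aE : a = \sum_(k <- index_enum 'I_N) a k 0 *: delta_mx k 0.
    rewrite [LHS]matrix_sum_delta; apply: eq_bigr => k _.
    by rewrite big_ord_recl big_ord0 addr0.
  rewrite {1}aE key//; last exact: index_enum_uniq.
  by apply: eq_integral => t _; rewrite expR_sum.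
elim: r => [_|k r IH /= /andP[kr ur]] g mg g0.
  by apply: eq_integral => t _; rewrite !big_nil addr0 mulr1.
set b := \sum_(j <- r) _ in IH *.
(* As the list has no duplicates, the remaining shift [b] leaves coordinate [k] fixed, so the tilt
   at [k] may be evaluated after the shift. *)
have bk : b k 0 = 0.
  rewrite /b summxE big_seq big1// => j jr; rewrite !mxE eqxx andbT.
  by case: eqP => [kj|]; rewrite ?mulr0//; rewrite kj jr in kr.
transitivity (\int[P]_t (g (xi t + a k 0 *: delta_mx k 0 + b))%:E)%E.
  by apply: eq_integral => t _; rewrite big_cons addrA.
rewrite (@cameron_martin_coord k (a k 0) (fun v => g (v + b)))//; last first.
  exact: measurableT_comp mg (measurable_fun_addC _).
transitivity (\int[P]_t
    (g (xi t + b) * tilt k (a k 0) ((xi t + b) k 0))%:E)%E.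
  by apply: eq_integral => t _; rewrite mxE bk addr0.
rewrite (IH ur (fun v => g v * tilt k (a k 0) ((v : 'cV[R]_N) k 0))).
- by apply: eq_integral => t _; rewrite big_cons mulrA.
- apply: measurable_funM => //.
  exact: measurableT_comp (mtilt k (a k 0)) (measurable_fun_coord k).
- by move=> v; rewrite mulr_ge0// expR_ge0.
Qed.

End cameron_martin.

(** * Cross-moment matrices *)

Section square_integrable.
Context {R : realType} {dT : measure_display} {T : measurableType dT}.
Context (P : probability T R).

Definition L2 (f : T -> R) : Prop :=
  measurable_fun setT f /\ P.-integrable setT (fun t => (f t ^+ 2)%:E).

Definition L2v m (F : T -> 'cV[R]_m) : Prop := forall i, L2 (fun t => F t i 0).

(** The second-moment matrix E[F G^T], without centering. *)
Definition cross m k (F : T -> 'cV[R]_m) (G : T -> 'cV[R]_k) : 'M[R]_(m, k) :=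
  \matrix_(i, j) \int[P]_t (F t i 0 * G t j 0).

Lemma L2_dominated (f g : T -> R) : measurable_fun setT f ->
  P.-integrable setT (fun t => (g t)%:E) -> (forall t, f t ^+ 2 <= g t) -> L2 f.
Proof.
move=> mf ig fg; split=> //; apply: (le_integrable measurableT _ _ ig).
  by apply/measurable_EFinP; exact: measurable_funX.
move=> t _; rewrite lee_fin [leLHS]ger0_norm ?sqr_ge0//.
exact: le_trans (fg t) (ler_norm _).
Qed.

(** Domination by [f^2 + g^2]. *)
Lemma L2M_integrable (f g : T -> R) : L2 f -> L2 g ->
  P.-integrable setT (fun t => (f t * g t)%:E).
Proof.
move=> [mf jf] [mg jg].
apply: (le_integrable measurableT _ _ (integrableD measurableT jf jg)).
  by apply/measurable_EFinP; exact: measurable_funM.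
move=> t _; rewrite /= lee_fin.
rewrite [leRHS]ger0_norm ?addr_ge0 ?sqr_ge0// ler_norml.
by apply/andP; split; have := sqr_ge0 (f t + g t); have := sqr_ge0 (f t - g t);
  have := sqr_ge0 (f t); have := sqr_ge0 (g t); nra.
Qed.

Lemma L2D (f g : T -> R) : L2 f -> L2 g -> L2 (fun t => f t + g t).
Proof.
move=> [mf jf] [mg jg].
have j2 := integrableZl measurableT 2 (integrableD measurableT jf jg).
apply: (@L2_dominated _ (fun t => 2 * (f t ^+ 2 + g t ^+ 2))).
- exact: measurable_funD.
- exact: j2.
- by move=> t; have := sqr_ge0 (f t - g t); nra.
Qed.

Lemma L2Z (c : R) (f : T -> R) : L2 f -> L2 (fun t => c * f t).
Proof.
move=> [mf jf]; apply: (@L2_dominated _ (fun t => c ^+ 2 * f t ^+ 2)).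
- exact: measurable_funM.
- exact: (integrableZl measurableT (c ^+ 2) jf).
- by move=> t; rewrite exprMn.
Qed.

Lemma L2_cst (c : R) : L2 (cst c).
Proof. by split=> //; exact: (finite_measure_integrable_cst P (c ^+ 2)). Qed.

Lemma L2_sum (I : Type) (r : seq I) (f : I -> T -> R) :
  (forall i, L2 (f i)) -> L2 (fun t => \sum_(i <- r) f i t).
Proof.
move=> lf; elim: r => [|i r IH].
  by under eq_fun do rewrite big_nil; exact: (L2_cst 0).
by under eq_fun do rewrite big_cons; exact: L2D.
Qed.

Lemma L2_integrable (f : T -> R) : L2 f -> P.-integrable setT (EFin \o f).
Proof.
move=> lf; have := L2M_integrable lf (L2_cst 1).
by under eq_fun do rewrite mulr1.
Qed.

Lemma L2vD m (F G : T -> 'cV[R]_m) : L2v F -> L2v G -> L2v (fun t => F t + G t).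
Proof. by move=> lF lG i; under eq_fun do rewrite mxE; exact: L2D. Qed.

Lemma L2v_mulmx m k (B : 'M[R]_(k, m)) (F : T -> 'cV[R]_m) :
  L2v F -> L2v (fun t => B *m F t).
Proof.
by move=> lF i; under eq_fun do rewrite mxE; apply: L2_sum => j; exact: L2Z.
Qed.

Lemma crossC m k (F : T -> 'cV[R]_m) (G : T -> 'cV[R]_k) :
  (cross F G)^T = cross G F.
Proof.
apply/matrixP => i j; rewrite !mxE; apply: eq_Rintegral => t _.
by rewrite mulrC.
Qed.

Lemma integrable_sumR (I : Type) (r : seq I) (f : I -> T -> R) :
  (forall i, P.-integrable setT (EFin \o f i)) ->
  P.-integrable setT (EFin \o (fun t => \sum_(i <- r) f i t)).
Proof.
move=> jf; elim: r => [|i r IH].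
  under eq_fun do rewrite big_nil.
  exact: (finite_measure_integrable_cst P 0).
under eq_fun do rewrite big_cons.
exact: (integrableD measurableT (jf i) IH).
Qed.

Lemma Rintegral_sum (I : Type) (r : seq I) (f : I -> T -> R) :
  (forall i, P.-integrable setT (EFin \o f i)) ->
  \int[P]_t (\sum_(i <- r) f i t) = \sum_(i <- r) \int[P]_t f i t.
Proof.
move=> jf; elim: r => [|i r IH].
  under eq_fun do rewrite big_nil.
  by rewrite big_nil Rintegral_cst// mul0r.
under eq_fun do rewrite big_cons.
by rewrite big_cons -IH RintegralD//; exact: integrable_sumR.
Qed.

Lemma cross_mull m k p (B : 'M[R]_(p, m)) (F : T -> 'cV[R]_m)
    (G : T -> 'cV[R]_k) : L2v F -> L2v G ->
  cross (fun t => B *m F t) G = B *m cross F G.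
Proof.
move=> lF lG; apply/matrixP => i j; rewrite !mxE.
under eq_Rintegral do rewrite mxE mulr_suml.
rewrite Rintegral_sum => [|l]; last first.
  apply: (@L2M_integrable (fun t => B i l * F t l 0) (fun t => G t j 0)).
    exact: L2Z.
  exact: lG.
apply: eq_bigr => l _; rewrite mxE.
under eq_Rintegral do rewrite -mulrA.
by rewrite RintegralZl//; exact: L2M_integrable.
Qed.

Lemma cross_addl m k (F F' : T -> 'cV[R]_m) (G : T -> 'cV[R]_k) :
  L2v F -> L2v F' -> L2v G ->
  cross (fun t => F t + F' t) G = cross F G + cross F' G.
Proof.
move=> lF lF' lG; apply/matrixP => i j; rewrite !mxE.
under eq_Rintegral do rewrite mxE mulrDl.
by rewrite RintegralD//; exact: L2M_integrable.
Qed.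

Lemma cross_mulr m k p (B : 'M[R]_(p, k)) (F : T -> 'cV[R]_m)
    (G : T -> 'cV[R]_k) : L2v F -> L2v G ->
  cross F (fun t => B *m G t) = cross F G *m B^T.
Proof.
by move=> lF lG; rewrite -[LHS]crossC cross_mull// trmx_mul crossC.
Qed.

Lemma cross_addr m k (F : T -> 'cV[R]_m) (G G' : T -> 'cV[R]_k) :
  L2v F -> L2v G -> L2v G' ->
  cross F (fun t => G t + G' t) = cross F G + cross F G'.
Proof.
move=> lF lG lG'.
by rewrite -[LHS]crossC cross_addl// linearD/= !crossC.
Qed.

(** Since F^T S F = tr(S F F^T), quadratic risks become traces against moment matrices, to which
    matrix algebra applies. *)
Lemma Ex_sqnormS m (S : 'M[R]_m) (F : T -> 'cV[R]_m) : L2v F ->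
  Ex P (fun t => sqnormS S (F t)) = (\tr (S *m cross F F))%:E.
Proof.
move=> lF.
have jF i j : P.-integrable setT (EFin \o (fun t => F t i 0 * S i j * F t j 0)).
  apply: (@L2M_integrable (fun t => F t i 0 * S i j) (fun t => F t j 0)) => //.
  by under eq_fun do rewrite mulrC; exact: L2Z.
have jF2 i : P.-integrable setT
    (EFin \o (fun t => \sum_(j < m) F t i 0 * S i j * F t j 0)).
  exact: integrable_sumR.
rewrite /Ex -[LHS]fineK; last first.
  by apply: integrable_fin_num => //; exact: integrable_sumR.
congr EFin; transitivity (\int[P]_t
    (\sum_(i < m) \sum_(j < m) F t i 0 * S i j * F t j 0)) => //.
rewrite Rintegral_sum// /mxtrace; apply: eq_bigr => i _.
rewrite Rintegral_sum// mxE; apply: eq_bigr => j _; rewrite mxE.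
rewrite -RintegralZl//; last exact: L2M_integrable.
by apply: eq_Rintegral => t _; ring.
Qed.

Lemma cross_psd m (S : 'M[R]_m) (F : T -> 'cV[R]_m) : L2v F ->
  (forall v : 'cV[R]_m, 0 <= sqnormS S v) -> 0 <= \tr (S *m cross F F).
Proof.
move=> lF S0; rewrite -lee_fin -Ex_sqnormS//; apply: integral_ge0 => t _.
by rewrite lee_fin.
Qed.

End square_integrable.

Lemma sqnorm_sqnormS (R : realType) m (v : 'cV[R]_m) :
  sqnorm v = sqnormS 1%:M v.
Proof.
rewrite /sqnorm /sqnormS; apply: eq_bigr => i _.
rewrite (bigD1 i)//= big1 ?addr0 => [|j /negPf ji].
  by rewrite !mxE eqxx mulr1 expr2.
by rewrite !mxE eq_sym ji mulr0 mul0r.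
Qed.

(** * Gaussian orthogonality *)

(** For x >= 0, square e^(x/2) >= 1 + x/2. The bound deduces second moments from exponential
    ones. *)
Lemma sqr_le_expR (R : realType) (x : R) : x ^+ 2 <= 4 * (expR x + expR (- x)).
Proof.
wlog x0 : x / 0 <= x => [H|].
  have [/H//|/ltW x0] := leP 0 x.
  by have := H (- x); rewrite oppr_ge0 sqrrN opprK addrC => ->.
have e2 : expR x = expR (x / 2) ^+ 2 by rewrite expr2 -expRD -splitr.
have := expR_ge1Dx (x / 2); have := expR_ge0 (- x).
by rewrite e2; nra.
Qed.

Section gaussian_orthogonality.
Context {R : realType} {dT : measure_display} {T : measurableType dT}.
Context (P : probability T R) {N : nat} (xi : T -> 'cV[R]_N) (s : 'I_N -> R).
Hypothesis mxi : forall k, measurable_fun setT (fun t => xi t k 0).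
Hypothesis s0 : forall k, s k != 0.
Hypothesis xi_law : forall A : 'I_N -> set R, (forall k, measurable (A k)) ->
  P [set t | forall k, A k (xi t k 0)] =
  (\prod_(k < N) normal_prob 0 (s k) (A k))%E.

Let CM := cameron_martin mxi s0 xi_law.

(* Exponential moments, hence second moments, come from Cameron-Martin applied
   to the constant function 1. *)
Lemma L2_gaussian : L2v P xi.
Proof.
move=> k.
have expint (c : R) : P.-integrable setT (fun t => (expR (c * xi t k 0 / s k ^+ 2))%:E).
  have := @CM (c *: delta_mx k 0) (fun=> 1) (measurable_cst _) (fun=> ler01).
  have -> : (\int[P]_t 1%:E = 1)%E.
    by rewrite integral_cst// mul1e; exact: probability_setT.
  have -> : (\int[P]_t (1 * expR (\sum_(j < N)
      ((c *: delta_mx k 0 : 'cV[R]_N) j 0 * xi t j 0 / s j ^+ 2 -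
       (c *: delta_mx k 0 : 'cV[R]_N) j 0 ^+ 2 / (s j ^+ 2 *+ 2))))%:E =
    \int[P]_t ((expR (- (c ^+ 2 / (s k ^+ 2 *+ 2))))%:E *
      (expR (c * xi t k 0 / s k ^+ 2))%:E))%E.
    apply: eq_integral => t _; rewrite mul1r -EFinM -expRD addrC.
    rewrite (bigD1 k)//= big1 ?addr0 => [|j /negPf jk].
      by rewrite !mxE !eqxx mulr1.
    by rewrite !mxE jk/= mulr0 expr0n/= !mul0r subrr.
  have mE : measurable_fun setT (fun t => (expR (c * xi t k 0 / s k ^+ 2))%:E).
    apply/measurable_EFinP; apply: measurableT_comp => //.
    by apply: measurable_funM => //; exact: measurable_funM.
  rewrite ge0_integralZl//.
  move=> H; apply/integrableP; split=> //.
  under eq_integral do rewrite gee0_abs ?lee_fin ?expR_ge0//.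
  rewrite ltey; apply/eqP => oo; move: H; rewrite oo.
  by rewrite mulry gtr0_sg ?expR_gt0// mul1e.
apply: (@L2_dominated _ _ _ _ _
  (fun t => 4 * (expR (xi t k 0) + expR (- xi t k 0)))) => //; last first.
  by move=> t; exact: sqr_le_expR.
have j1 := expint (s k ^+ 2); have j2 := expint (- s k ^+ 2).
have := integrableZl measurableT 4 (integrableD measurableT j1 j2).
apply: eq_integrable => // t _ /=.
have sk : s k ^+ 2 != 0 by rewrite expf_neq0.
by rewrite mulNr mulNr ![s k ^+ 2 * _]mulrC mulfK.
Qed.

(** The part of the Cameron-Martin exponent that is linear in the shift [a]: up to sign, the
    Gaussian score in direction [a]. *)
Definition score (a v : 'cV[R]_N) := \sum_(k < N) a k 0 * v k 0 / s k ^+ 2.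

Lemma L2_score (a : 'cV[R]_N) : L2 P (fun t => score a (xi t)).
Proof.
apply: L2_sum => k; under eq_fun do rewrite mulrAC.
by apply: L2Z; exact: L2_gaussian.
Qed.

(* As [L a = 0], shifting by [r a] preserves [g (L xi)], so with [U] the score
   E[g] = E[g exp(r U - r^2 c)] >= E[g (1 + r U - r^2 c)] for every [r] of either
   sign; this forces E[g U] = 0. *)
Lemma score_orthogonal_ge0 p (L : 'M[R]_(p, N)) (a : 'cV[R]_N)
    (g : cylT R p -> R) : L *m a = 0 -> measurable_fun setT g ->
  (forall v, 0 <= g v) -> L2 P (fun t => g (L *m xi t)) ->
  \int[P]_t (g (L *m xi t) * score a (xi t)) = 0.
Proof.
move=> La mg g0 lg.
pose c := \sum_(k < N) a k 0 ^+ 2 / (s k ^+ 2 *+ 2).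
have jg := L2_integrable lg.
have jgU : P.-integrable setT
    (EFin \o (fun t => g (L *m xi t) * score a (xi t))).
  exact: L2M_integrable lg (L2_score a).
have mgL : measurable_fun setT (fun v : cylT R N => g (L *m v)).
  apply: (measurableT_comp mg); apply: measurable_fun_cylT.
  by apply: measurable_fun_mulmx => j; exact: measurable_fun_coord.
have mgLxi : measurable_fun setT (fun t => g (L *m xi t)) by case: lg.
set I := \int[P]_t _; pose G := \int[P]_t g (L *m xi t).
have G0 : 0 <= G by apply: Rintegral_ge0.
have c0 : 0 <= c.
  apply: sumr_ge0 => k _; rewrite divr_ge0 ?sqr_ge0//.
  by rewrite mulrn_wge0// sqr_ge0.
have key r : r * I <= r ^+ 2 * (c * G).
  have := @CM (r *: a) (fun v => g (L *m v)) mgL (fun v => g0 _).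
  have -> : (\int[P]_t (g (L *m (xi t + r *: a)))%:E =
      \int[P]_t (g (L *m xi t))%:E)%E.
    apply: eq_integral => t _.
    by rewrite mulmxDr -scalemxAr La scaler0 addr0.
  pose W t := \sum_(k < N) ((r *: a) k 0 * xi t k 0 / s k ^+ 2 -
    (r *: a) k 0 ^+ 2 / (s k ^+ 2 *+ 2)).
  have WE t : W t = r * score a (xi t) - r ^+ 2 * c.
    rewrite /W /score /c !mulr_sumr -sumrB; apply: eq_bigr => k _.
    by rewrite mxE exprMn !mulrA.
  rewrite -[X in _ = X -> _]/(\int[P]_t (g (L *m xi t) * expR (W t))%:E)%E => H.
  have jgW : P.-integrable setT (fun t => (g (L *m xi t) * expR (W t))%:E).
    apply/integrableP; split.
      apply/measurable_EFinP/measurable_funM => //.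
      apply: measurableT_comp => //; rewrite (funext WE).
      apply: measurable_funB => //; apply: measurable_funM => //.
      by have [] := L2_score a.
    under eq_integral do rewrite gee0_abs ?lee_fin ?mulr_ge0 ?expR_ge0//.
    rewrite -H ltey_eq; apply/orP; left.
    exact: (integrable_fin_num measurableT jg).
  have GE : G = \int[P]_t (g (L *m xi t) * expR (W t)).
    by rewrite /G /Rintegral H.
  have jlin : P.-integrable setT (EFin \o (fun t => r * (g (L *m xi t) * score a (xi t)))).
    exact: (integrableZl measurableT r jgU).
  have jlin2 : P.-integrable setT (EFin \o (fun t => (1 - r ^+ 2 * c) * g (L *m xi t))).
    exact: (integrableZl measurableT (1 - r ^+ 2 * c) jg).
  (* From e^W >= 1 + W, the tilted integral is bounded below by a quadratic polynomial in [r]. *)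
  have le : \int[P]_t ((1 - r ^+ 2 * c) * g (L *m xi t) +
      r * (g (L *m xi t) * score a (xi t))) <= G.
    rewrite GE; apply: le_Rintegral => //.
      exact: (integrableD measurableT jlin2 jlin).
    move=> t _; have := expR_ge1Dx (W t); have := g0 (L *m xi t).
    by rewrite WE; nra.
  rewrite RintegralD// !RintegralZl// -/I -/G in le.
  by move: le; nra.
have K0 : 0 <= c * G by exact: mulr_ge0.
set K := c * G in key K0.
have Kp : 0 < 2 * (K + 1) by lra.
(* This [r] has the sign of [I] and is small enough to give I^2 <= I^2 K / (2 (K + 1)) <= I^2 / 2;
   the [+ 1] covers K = 0. *)
have := key (I / (2 * (K + 1))).
have -> : I / (2 * (K + 1)) * I = I ^+ 2 / (2 * (K + 1)) by rewrite mulrAC expr2.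
rewrite ler_pdivrMr// => le.
have {}le : I ^+ 2 <= I ^+ 2 * (K / (2 * (K + 1))).
  apply: le_trans le _; rewrite le_eqVlt; apply/orP; left; apply/eqP.
  by field; rewrite lt0r_neq0//; lra.
have : K / (2 * (K + 1)) <= 1 / 2.
  by rewrite ler_pdivrMr//; lra.
have := sqr_ge0 I => I0 Kle.
have I2 : I ^+ 2 = 0 by nra.
by apply/eqP; rewrite -sqrf_eq0 I2.
Qed.

(** The nonnegative case is applied to the positive and negative parts of [g]. *)
Lemma score_orthogonal p (L : 'M[R]_(p, N)) (a : 'cV[R]_N)
    (g : cylT R p -> R) : L *m a = 0 -> measurable_fun setT g ->
  L2 P (fun t => g (L *m xi t)) ->
  \int[P]_t (g (L *m xi t) * score a (xi t)) = 0.
Proof.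
move=> La mg lg.
have part (f : cylT R p -> R) : measurable_fun setT f ->
    L2 P (fun t => f (L *m xi t)) ->
    L2 P (fun t => Num.max (f (L *m xi t)) 0) /\
    \int[P]_t (Num.max (f (L *m xi t)) 0 * score a (xi t)) = 0.
  move=> mf lf.
  have lm : L2 P (fun t => Num.max (f (L *m xi t)) 0).
    apply: (@L2_dominated _ _ _ _ _ (fun t => f (L *m xi t) ^+ 2)).
    - by apply: measurable_maxr => //; case: lf.
    - by case: lf.
    - by move=> t; case: (leP (f _) 0) => // _; rewrite expr2 mul0r sqr_ge0.
  split=> //.
  apply: (@score_orthogonal_ge0 p L a (fun v => Num.max (f v) 0)) => //.
    exact: measurable_maxr.
  by move=> v; rewrite le_max lexx orbT.
have [lp Ip] := part g mg lg.
have lgN : L2 P (fun t => - g (L *m xi t)).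
  by under eq_fun do rewrite -mulN1r; exact: L2Z.
have mgN : measurable_fun setT (fun v => - g v) by exact: measurableT_comp.
have [ln In] := part (fun v => - g v) mgN lgN.
transitivity (\int[P]_t (Num.max (g (L *m xi t)) 0 * score a (xi t) -
    Num.max (- g (L *m xi t)) 0 * score a (xi t))).
  apply: eq_Rintegral => t _; rewrite -mulrBl; congr (_ * _).
  by case: (leP (g _) 0) => ?; case: (leP (- g _) 0) => ?; lra.
rewrite RintegralB//; first by rewrite Ip In subrr.
- exact: L2M_integrable lp (L2_score a).
- exact: L2M_integrable ln (L2_score a).
Qed.

(* If [b xi] vanished almost surely, so would its shift [b xi + |b|^2], since
   the shifted law is absolutely continuous. *)
Lemma gaussian_nondegenerate (b : 'rV[R]_N) : b != 0 ->
  0 < \int[P]_t (b *m xi t) 0 0 ^+ 2.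
Proof.
move=> b0; pose f t := (b *m xi t) 0 0.
have lf : L2 P f.
  have := L2v_mulmx b L2_gaussian; exact.
have [mf jf] := lf.
pose c := (b *m b^T) 0 0.
have c0 : 0 < c.
  have [k bk] : exists k, b 0 k != 0.
    apply/existsP; rewrite -negb_forall; apply: contra b0 => /forallP H.
    by apply/eqP/rowP => k; rewrite mxE; apply/eqP.
  rewrite /c mxE; under eq_bigr do rewrite mxE -expr2.
  rewrite (bigD1 k)//=; apply: ltr_pwDl.
    by rewrite exprn_even_gt0.
  by apply: sumr_ge0 => j _; exact: sqr_ge0.
rewrite lt_neqAle Rintegral_ge0 ?andbT; last by move=> t _; exact: sqr_ge0.
apply/eqP => /esym f20.
have f2e : (\int[P]_t (f t ^+ 2)%:E = 0)%E.
  rewrite -[LHS]fineK; last exact: (integrable_fin_num measurableT jf).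
  by congr EFin.
have f2ae : ae_eq P setT (fun t => (f t ^+ 2)%:E) (cst 0%E).
  apply/ae_eq_integral_abs => //.
    by apply/measurable_EFinP; exact: measurable_funX.
  by under eq_integral do rewrite gee0_abs ?lee_fin ?sqr_ge0//.
have mh : measurable_fun setT (fun v : cylT R N => (b *m (v : 'cV[R]_N)) 0 0 ^+ 2).
  apply: measurable_funX; apply: measurable_fun_mulmx => j.
  exact: measurable_fun_coord.
have := @CM b^T (fun v => (b *m v) 0 0 ^+ 2) mh (fun v => sqr_ge0 _).
pose W t := \sum_(k < N) (b^T k 0 * xi t k 0 / s k ^+ 2 -
  b^T k 0 ^+ 2 / (s k ^+ 2 *+ 2)).
have mW : measurable_fun setT W.
  apply: measurable_sum => k; apply: measurable_funB => //.
  by apply: measurable_funM => //; exact: measurable_funM.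
rewrite -[X in _ = X -> _]/(\int[P]_t (f t ^+ 2 * expR (W t))%:E)%E.
(* Since [f] vanishes almost surely, so does its square times any density. *)
rewrite [X in _ = X -> _](_ : _ = 0)%E; last first.
  rewrite (ae_eq_integral (cst 0%E))//; first exact: integral0.
  - apply/measurable_EFinP/measurable_funM.
      exact: measurable_funX.
    exact: measurableT_comp.
  - apply: filterS f2ae => t /(_ I) /= [ft].
    by move=> _; rewrite ft mul0r.
have -> : (\int[P]_t ((b *m (xi t + b^T)) 0 0 ^+ 2)%:E =
    \int[P]_t ((f t + c) ^+ 2)%:E)%E.
  by apply: eq_integral => t _; rewrite mulmxDr mxE.
move=> H.
have jfc : P.-integrable setT (EFin \o (fun t => (f t + c) ^+ 2)).
  by have [] := L2D lf (L2_cst P c).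
have Z : \int[P]_t (f t + c) ^+ 2 = 0 by rewrite /Rintegral H.
(* Both [f] and [f + c] would be null in mean square, yet (f + c)^2 + f^2 >= c^2 / 2. *)
have : \int[P]_t (c ^+ 2 / 2) <= \int[P]_t ((f t + c) ^+ 2 + f t ^+ 2).
  apply: le_Rintegral => //.
  - exact: (finite_measure_integrable_cst P (c ^+ 2 / 2)).
  - exact: (integrableD measurableT jfc jf).
  - by move=> t _; have := sqr_ge0 (c + 2 * f t); nra.
rewrite RintegralD// Z f20 addr0 Rintegral_cst//.
rewrite [X in _ * fine X]probability_setT mulr1.
by have : 0 < c ^+ 2 by [exact: exprn_gt0]; lra.
Qed.

End gaussian_orthogonality.

Lemma sqnormSE (R : realType) m (S : 'M[R]_m) (v : 'cV[R]_m) :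
  sqnormS S v = (v^T *m S *m v) 0 0.
Proof.
rewrite /sqnormS mxE exchange_big; apply: eq_bigr => j _.
by rewrite mxE mulr_suml; apply: eq_bigr => i _; rewrite mxE.
Qed.

(** * The posterior mean in the Gaussian linear model *)

Section bayes_model.
Context {R : realType} {dT : measure_display} {T : measurableType dT}.
Context (P : probability T R) {n d : nat} (X : 'M[R]_(n, d)) (sigma : R).
Context (theta : 'I_d -> T -> R) (w : 'I_n -> T -> R).
Hypotheses (d_gt0 : (0 < d)%N) (sigma_gt0 : 0 < sigma).
Hypothesis model : gaussian_model P sigma theta w.

(** Signal and noise are stacked into one Gaussian vector with independent coordinates, and [y] is
    its image under [L]; the orthogonality lemmas take this form. *)
Let xi t : 'cV[R]_(d + n) := col_mx (thetaV theta t) (wV w t).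
Let sd (k : 'I_(d + n)) : R :=
  if fintype.split k is inl _ then Num.sqrt (d%:R^-1) else sigma.
Let L : 'M[R]_(n, d + n) := row_mx X 1%:M.
Let y := yV X theta w.

Let d0 : 0 < d%:R :> R. Proof. by rewrite ltr0n. Qed.

Let xil t i : xi t (lshift n i) 0 = theta i t.
Proof. by rewrite /xi col_mxEu mxE. Qed.

Let xir t j : xi t (rshift d j) 0 = w j t.
Proof. by rewrite /xi col_mxEd mxE. Qed.

Let sdl i : sd (lshift n i) = Num.sqrt (d%:R^-1).
Proof. by rewrite /sd (fintype.unsplitK (inl i)). Qed.

Let sdr j : sd (rshift d j) = sigma.
Proof. by rewrite /sd (fintype.unsplitK (inr j)). Qed.

Let sd0 k : sd k != 0.
Proof.
by rewrite /sd; case: fintype.split => _; rewrite ?lt0r_neq0// sqrtr_gt0 invr_gt0.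
Qed.

Let mxi k : measurable_fun setT (fun t => xi t k 0).
Proof.
have [mt [mw _]] := model.
rewrite -(fintype.splitK k); case: (fintype.split k) => j /=.
  by under eq_fun do rewrite xil; exact: mt.
by under eq_fun do rewrite xir; exact: mw.
Qed.

Let xi_law (A : 'I_(d + n) -> set R) : (forall k, measurable (A k)) ->
  P [set t | forall k, A k (xi t k 0)] =
  (\prod_(k < d + n) normal_prob 0 (sd k) (A k))%E.
Proof.
move=> mA; have [_ [_ law]] := model.
have lawA := law (fun i => A (lshift n i)) (fun j => A (rshift d j))
  (fun i => mA _) (fun j => mA _).
rewrite big_split_ord/=.
under eq_bigr do rewrite sdl.
under [X in (_ * X)%E]eq_bigr do rewrite sdr.
rewrite -[RHS]lawA; congr (P _); apply/seteqP; split=> t /= H.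
  by split=> [i|j]; [rewrite -xil|rewrite -xir]; exact: H.
move=> k; rewrite -(fintype.splitK k); case: (fintype.split k) => j /=.
  by rewrite xil; exact: H.1.
by rewrite xir; exact: H.2.
Qed.

Let yE t : y t = L *m xi t.
Proof. by rewrite /L /xi mul_row_col mul1mx. Qed.

Lemma L2v_theta : L2v P (thetaV theta).
Proof.
move=> i; have -> : (fun t => thetaV theta t i 0) =
    (fun t => xi t (lshift n i) 0) by apply/funext => t; rewrite xil mxE.
exact: L2_gaussian mxi sd0 xi_law (lshift n i).
Qed.

Lemma L2v_y : L2v P y.
Proof.
rewrite (funext yE); apply: L2v_mulmx; exact: L2_gaussian mxi sd0 xi_law.
Qed.

(* The inverse covariance of [theta] given [y]. *)
Definition precision : 'M[R]_d := d%:R%:M + sigma ^- 2 *: (X^T *m X).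

(** The shift [a = (p, - X p)] is in the kernel of [L]. For [p] the [i]-th basis vector, its score
    is the [i]-th entry of [precision theta - sigma^-2 X^T y], which is therefore orthogonal to
    functions of [y]. *)
Lemma posterior_orthogonal k (g : 'cV[R]_n -> 'cV[R]_k) :
  borel_map g -> L2v P (g \o y) ->
  precision *m cross P (thetaV theta) (g \o y) =
  sigma ^- 2 *: X^T *m cross P y (g \o y).
Proof.
move=> bg lg; have lt := L2v_theta; have ly := L2v_y.
apply/eqP; rewrite -subr_eq0 -mulNmx -!cross_mull//.
rewrite -cross_addl//; try exact: L2v_mulmx.
apply/eqP/matrixP => i j; rewrite !mxE.
pose p : 'cV[R]_d := delta_mx i 0.
pose a : 'cV[R]_(d + n) := col_mx p (- (X *m p)).
have La : L *m a = 0 by rewrite mul_row_col mul1mx subrr.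
have mg : measurable_fun setT (fun v : cylT R n => g v j 0).
  by move=> _ B mB; rewrite setTI; exact: bg.
have lgj : L2 P (fun t => g (L *m xi t) j 0).
  by have := lg j; under eq_fun do rewrite /= yE.
have := score_orthogonal mxi sd0 xi_law La mg lgj.
move=> <-; apply: eq_Rintegral => t _ /=; rewrite -yE mulrC; congr (_ * _).
rewrite /score big_split_ord/=.
under eq_bigr do rewrite col_mxEu sdl xil sqr_sqrtr ?invr_ge0 ?ler0n// invrK.
under [X in _ = _ + X]eq_bigr do rewrite col_mxEd sdr xir.
rewrite (bigD1 i)//= big1 ?addr0; last first.
  by move=> k' /negPf ki; rewrite mxE ki/= !mul0r.
have -> : p i 0 = 1 by rewrite mxE !eqxx.
rewrite mul1r.
(* Substituting for [y] cancels the [X^T X] term of [precision] and leaves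
   [d theta - sigma^-2 X^T w]. *)
have -> : y t = X *m thetaV theta t + wV w t by [].
rewrite /precision mulmxDl mul_scalar_mx mulmxDr !mulNmx.
rewrite -!scalemxAl mulmxA addrA addrK.
rewrite !mxE; congr (_ + _); first by rewrite mulrC.
rewrite mulr_sumr -sumrN; apply: eq_bigr => l _.
rewrite !mxE (bigD1 i)//= big1 ?addr0; last first.
  by move=> k' /negPf ki; rewrite !mxE ki mulr0.
by rewrite !mxE !eqxx mulr1; ring.
Qed.

(** The matrix is positive definite: its form at u is at least d |u|^2. *)
Lemma precision_unit : precision \in unitmx.
Proof.
rewrite -row_free_unit -kermx_eq0; apply/rowV0P => u /sub_kermxP uQ.
apply/eqP; apply: contraT => u0.
have : (u *m precision *m u^T) 0 0 = 0 by rewrite uQ mul0mx mxE.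
rewrite /precision mulmxDr mulmxDl mxE mul_mx_scalar -scalemxAl mxE.
have -> : u *m (sigma ^- 2 *: (X^T *m X)) *m u^T =
    sigma ^- 2 *: ((X *m u^T)^T *m (X *m u^T)).
  by rewrite -scalemxAr -scalemxAl trmx_mul trmxK !mulmxA.
rewrite [X in _ + X]mxE => H; suff : 0 < d%:R * (u *m u^T) 0 0 + sigma ^- 2 * ((X *m u^T)^T *m (X *m u^T)) 0 0.
  by rewrite H ltxx.
apply: ltr_pwDl.
  rewrite mulr_gt0// lt_neqAle eq_sym; apply/andP; split; last first.
    by rewrite mxE sumr_ge0// => i _; rewrite mxE -expr2 sqr_ge0.
  apply: contra u0; rewrite mxE psumr_eq0 => [/allP u2|i _]; last first.
    by rewrite mxE -expr2 sqr_ge0.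
  apply/eqP/rowP => i; rewrite mxE; have := u2 i (mem_index_enum i).
  by rewrite mxE -expr2 sqrf_eq0 => /eqP.
rewrite mulr_ge0 ?invr_ge0 ?sqr_ge0// mxE sumr_ge0// => i _.
by rewrite mxE -expr2 sqr_ge0.
Qed.

(** The ridge regression matrix (X^T X + d sigma^2 I)^-1 X^T. *)
Definition bayes : 'M[R]_(d, n) :=
  invmx precision *m (sigma ^- 2 *: X^T).

Lemma cross_bayes k (g : 'cV[R]_n -> 'cV[R]_k) :
  borel_map g -> L2v P (g \o y) ->
  cross P (thetaV theta) (g \o y) = bayes *m cross P y (g \o y).
Proof.
move=> bg lg; rewrite -mulmxA -posterior_orthogonal// mulmxA mulVmx ?mul1mx//.
exact: precision_unit.
Qed.

(** The form [u^T y] is the image of the Gaussian vector under [u^T L], which is nonzero because [L]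
    contains an identity block. *)
Lemma cross_y_spd : spd (cross P y y).
Proof.
split; first exact: crossC.
move=> u u0; rewrite sqnormSE; have ly := L2v_y.
have -> : u^T *m cross P y y *m u =
    cross P (fun t => u^T *m y t) (fun t => u^T *m y t).
  rewrite cross_mull//; last exact: L2v_mulmx.
  by rewrite cross_mulr// trmxK mulmxA.
rewrite mxE; have b0 : u^T *m L != 0.
  apply: contra u0 => /eqP; rewrite mul_mx_row mulmx1 => /(congr1 rsubmx).
  by rewrite row_mxKr => /(congr1 trmx); rewrite trmxK => ->; rewrite !raddf0.
have := gaussian_nondegenerate mxi sd0 xi_law b0.
by under eq_Rintegral do rewrite -mulmxA -yE expr2.
Qed.

End bayes_model.

(** * Quadratic forms *)

Section extremal_ratio.
Context {R : realType} (m : nat).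
Implicit Types q : 'rV[R]_m -> R.

(** The ratio q1 / q2 is homogeneous of degree zero, so a maximum on the compact unit sphere is
    global. Denominators are cleared to include x = 0. The lemma serves both for Rayleigh quotients
    and for coercivity. *)
Lemma quadratic_ratio_max q1 q2 : (0 < m)%N ->
  continuous q1 -> continuous q2 ->
  (forall (t : R) x, q1 (t *: x) = t ^+ 2 * q1 x) ->
  (forall (t : R) x, q2 (t *: x) = t ^+ 2 * q2 x) ->
  (forall x, x != 0 -> 0 < q2 x) ->
  exists2 x0, x0 != 0 & forall x, q1 x * q2 x0 <= q1 x0 * q2 x.
Proof.
case: m q1 q2 => // m' q1 q2 _ c1 c2 h1 h2 pos.
pose S : set 'rV[R]_m'.+1 := [set x | `|x| = 1].
have S0 x : S x -> x != 0.
  by move=> Sx; rewrite -normr_eq0 Sx oner_eq0.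
have nS x : x != 0 -> S (`|x|^-1 *: x).
  by move=> x0; rewrite /S/= normrZ normfV normr_id mulVf// normr_eq0.
have Sne : S !=set0.
  exists (`|const_mx 1 : 'rV[R]_m'.+1|^-1 *: const_mx 1); apply: nS.
  by apply/eqP => /rowP/(_ 0); rewrite !mxE => /eqP; rewrite oner_eq0.
have cS : compact S.
  apply: bounded_closed_compact.
    exists 1; split; first exact: real1.
    by move=> M M1 x Sx /=; rewrite Sx; exact: ltW.
  apply: (@closed_comp _ _ (fun x : 'rV[R]_m'.+1 => `|x|) [set 1]).
    by move=> x _; exact: norm_continuous.
  exact: closed_eq.
have cq : {within S, continuous (fun x => q1 x / q2 x)}.
  apply: continuous_in_subspaceT => x /[!inE] Sx.
  have q2x : q2 x != 0 by rewrite lt0r_neq0// pos// S0.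
  exact: cvgM (c1 x) (cvgV q2x (c2 x)).
have [x0 /[!inE] Sx0 mx] := compact_EVT_max Sne cS cq.
exists x0; first exact: S0.
move=> x; have [->|x_neq0] := eqVneq x 0.
  by rewrite -(scale0r 0) h1 h2 expr0n/= !mul0r mulr0.
have nx : `|x| != 0 by rewrite normr_eq0.
have /mx : (`|x|^-1 *: x) \in S.
  by rewrite inE; exact: nS.
rewrite h1 h2 -mulf_div divff ?mul1r; last first.
  by rewrite expf_neq0// invr_eq0.
by rewrite ler_pdivrMr ?pos// mulrAC ler_pdivlMr ?pos// S0.
Qed.

End extremal_ratio.

(** * Entrywise continuity of matrix-valued maps *)

Section matrix_continuity.
Context {R : realType} (m : nat).

Definition contM p q (F : 'rV[R]_m -> 'M[R]_(p, q)) : Prop :=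
  forall i j, continuous (fun x => F x i j).

Lemma contM_cst p q (A : 'M[R]_(p, q)) : contM (fun=> A).
Proof. by move=> i j; exact: cst_continuous. Qed.

Lemma continuous_sumR (I : Type) (r : seq I) (f : I -> 'rV[R]_m -> R) :
  (forall i, continuous (f i)) -> continuous (fun x => \sum_(i <- r) f i x).
Proof.
move=> cf; elim: r => [|i r IH].
  by under eq_fun do rewrite big_nil; exact: cst_continuous.
by under eq_fun do rewrite big_cons; move=> x; exact: cvgD (cf i x) (IH x).
Qed.

Lemma contM_mul p q r (F : 'rV[R]_m -> 'M[R]_(p, q))
    (G : 'rV[R]_m -> 'M[R]_(q, r)) :
  contM F -> contM G -> contM (fun x => F x *m G x).
Proof.
move=> cF cG i j; under eq_fun do rewrite mxE.
by apply: continuous_sumR => k x; exact: cvgM (cF i k x) (cG k j x).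
Qed.

Lemma contM_sub p q (F G : 'rV[R]_m -> 'M[R]_(p, q)) :
  contM F -> contM G -> contM (fun x => F x - G x).
Proof.
move=> cF cG i j; under eq_fun do rewrite !mxE.
by move=> x; exact: cvgB (cF i j x) (cG i j x).
Qed.

Lemma contM_tr p q (F : 'rV[R]_m -> 'M[R]_(p, q)) :
  contM F -> contM (fun x => (F x)^T).
Proof. by move=> cF i j; under eq_fun do rewrite mxE; exact: cF. Qed.

Lemma continuous_mxtrace p (F : 'rV[R]_m -> 'M[R]_p) :
  contM F -> continuous (fun x => \tr (F x)).
Proof. by move=> cF; apply: continuous_sumR => i; exact: cF. Qed.

End matrix_continuity.

Lemma contM_vec_mx (R : realType) p q :
  contM (fun x : 'rV[R]_(p * q) => vec_mx x).
Proof.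
move=> i j; under eq_fun do rewrite mxE; exact: coord_continuous.
Qed.

Lemma contM_id (R : realType) m : contM (fun x : 'rV[R]_m => x).
Proof. by move=> i j; exact: coord_continuous. Qed.

(** * Rayleigh quotients, rank-one updates and the linear improvement *)

Section matrix_quadratics.
Context {R : realType}.

Lemma sqnormSB m (S : 'M[R]_m) (N : 'M[R]_m) (l : R) (v : 'cV[R]_m) :
  sqnormS (l *: S - N) v = l * sqnormS S v - sqnormS N v.
Proof.
by rewrite !sqnormSE mulmxBr mulmxBl -scalemxAr -scalemxAl !mxE.
Qed.

Lemma trmxZ m n (t : R) (A : 'M[R]_(m, n)) : (t *: A)^T = t *: A^T.
Proof. exact: linearZ. Qed.

Lemma sqnormSZ m (S : 'M[R]_m) (t : R) (v : 'cV[R]_m) :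
  sqnormS S (t *: v) = t ^+ 2 * sqnormS S v.
Proof.
by rewrite !sqnormSE trmxZ -!scalemxAl -scalemxAr scalerA mxE expr2.
Qed.

(** With z = N v, nonnegativity of the form at v + t z for every real t forces |z|^2 = 0. *)
Lemma psd_kernel m (N : 'M[R]_m) (v : 'cV[R]_m) : N^T = N ->
  (forall x : 'cV[R]_m, 0 <= sqnormS N x) -> sqnormS N v = 0 -> N *m v = 0.
Proof.
move=> sN pN qv; pose z := N *m v; pose a := (z^T *m z) 0 0.
have aE : a = \sum_i z i 0 ^+ 2.
  by rewrite /a mxE; apply: eq_bigr => i _; rewrite mxE expr2.
have a0 : 0 <= a by rewrite aE sumr_ge0// => i _; exact: sqr_ge0.
have key t : 0 <= 2 * t * a + t ^+ 2 * sqnormS N z.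
  have := pN (v + t *: z).
  have E1 : v^T *m N *m z = z^T *m z by rewrite [in RHS]/z trmx_mul sN.
  have E2 : z^T *m N *m v = z^T *m z by rewrite -mulmxA.
  have -> : sqnormS N (v + t *: z) = 2 * t * a + t ^+ 2 * sqnormS N z.
    rewrite sqnormSE [(v + t *: z)^T]linearD/= trmxZ !mulmxDl !mulmxDr.
    rewrite -!scalemxAl -!scalemxAr E1 E2.
    have eD (B C : 'M[R]_1) : (B + C) 0 0 = B 0 0 + C 0 0 by rewrite mxE.
    have eZ r (B : 'M[R]_1) : (r *: B) 0 0 = r * B 0 0 by rewrite mxE.
    by rewrite !(eD, eZ) -!sqnormSE qv /a; ring.
  by [].
have a00 : a = 0.
  have q0 := pN z; set q := sqnormS N z in key q0.
  have qp : 0 < q + 1 by lra.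
  (* At this t the expression is - a^2 (q + 2) / (q + 1)^2; the [+ 1] covers q = 0. *)
  have := key (- a / (q + 1)).
  have -> : 2 * (- a / (q + 1)) * a + (- a / (q + 1)) ^+ 2 * q =
      - (a ^+ 2 * (q + 2)) / (q + 1) ^+ 2.
    by field; rewrite lt0r_neq0.
  rewrite ler_pdivlMr ?exprn_gt0// mul0r => le.
  have := sqr_ge0 a => a2.
  by apply/eqP; rewrite -sqrf_eq0; apply/eqP; nra.
apply/colP => i; rewrite [RHS]mxE; apply/eqP; rewrite -/z -sqrf_eq0.
move/eqP : a00; rewrite aE psumr_eq0 => [/allP H|j _]; last exact: sqr_ge0.
exact: H i (mem_index_enum i).
Qed.

(** At a maximizer of the Rayleigh quotient, with maximum l, the nonnegative form of [l S - W]
    vanishes, so the maximizer is in its kernel. *)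
Lemma generalized_top_eigenpair m (S W : 'M[R]_m) : (0 < m)%N ->
  spd S -> W^T = W ->
  exists v : 'cV[R]_m, exists l : R, [/\ sqnormS S v = 1, W *m v = l *: (S *m v)
    & forall x : 'cV[R]_m, sqnormS W x <= l * sqnormS S x].
Proof.
move=> m0 [sS pS] sW.
have cq (N : 'M[R]_m) : continuous (fun x : 'rV[R]_m => sqnormS N x^T).
  under eq_fun do rewrite sqnormSE trmxK.
  have cN : contM (fun x : 'rV[R]_m => x *m N *m x^T).
    apply: contM_mul; last by apply: contM_tr; exact: contM_id.
    by apply: contM_mul; [exact: contM_id|exact: contM_cst].
  exact: cN.
have hq (N : 'M[R]_m) (t : R) (x : 'rV[R]_m) :
    sqnormS N (t *: x)^T = t ^+ 2 * sqnormS N x^T.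
  by rewrite trmxZ sqnormSZ.
have pq (x : 'rV[R]_m) : x != 0 -> 0 < sqnormS S x^T.
  move=> x0; apply: pS; apply: contra x0 => /eqP/(congr1 trmx).
  by rewrite trmxK trmx0 => ->.
have [x0 x00 mx] := quadratic_ratio_max m0 (cq W) (cq S) (hq W) (hq S) pq.
have p0 := pq _ x00; set s := sqnormS S x0^T in mx p0.
have sn0 : s != 0 by rewrite lt0r_neq0.
pose r := (Num.sqrt s)^-1; pose l := sqnormS W x0^T / s.
have r2 : r ^+ 2 * s = 1 by rewrite exprVn sqr_sqrtr ?ltW// mulVf.
have le x : sqnormS W x <= l * sqnormS S x.
  by rewrite mulrAC ler_pdivlMr//; have := mx x^T; rewrite trmxK.
exists (r *: x0^T), l; split => //; first by rewrite sqnormSZ.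
have : (l *: S - W) *m (r *: x0^T) = 0.
  apply: psd_kernel.
  - by rewrite linearB/= trmxZ sS sW.
  - by move=> x; rewrite sqnormSB subr_ge0.
  - by rewrite sqnormSZ sqnormSB divfK// subrr mulr0.
by rewrite mulmxBl -scalemxAl => /eqP; rewrite subr_eq0 => /eqP <-.
Qed.

(** Effect of a rank-one correction on a quadratic risk, used with the prediction weight and with
    the identity. *)
Lemma trace_rank1_update p q (S : 'M[R]_p) (M : 'M[R]_q) (D : 'M[R]_(p, q))
    (v : 'cV[R]_p) (e : 'rV[R]_q) : S^T = S -> M^T = M ->
  \tr (S *m ((D - v *m e) *m M *m (D - v *m e)^T)) =
  \tr (S *m (D *m M *m D^T)) - 2 * (e *m M *m D^T *m S *m v) 0 0
  + sqnormS S v * (e *m M *m e^T) 0 0.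
Proof.
move=> sS sM.
have tr1 (C : 'M[R]_(q, p)) : \tr (S *m (v *m e *m C)) = (e *m C *m S *m v) 0 0.
  by rewrite -!mulmxA mulmxA mxtrace_mulC trace_mx11 !mulmxA.
rewrite linearB/= trmx_mul !mulmxBl !mulmxBr !linearB/=.
rewrite -[v *m e *m M]mulmxA.
have -> : \tr (S *m (D *m M *m (e^T *m v^T))) = (e *m M *m D^T *m S *m v) 0 0.
  rewrite -mxtrace_tr !trmx_mul !trmxK sS sM mxtrace_mulC.
  by rewrite tr1 !mulmxA.
have -> : \tr (S *m (v *m (e *m M) *m D^T)) = (e *m M *m D^T *m S *m v) 0 0.
  have -> : v *m (e *m M) *m D^T = v *m e *m (M *m D^T) by rewrite !mulmxA.
  by rewrite tr1 !mulmxA.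
have -> : \tr (S *m (v *m (e *m M) *m (e^T *m v^T))) =
    sqnormS S v * (e *m M *m e^T) 0 0.
  have -> : v *m (e *m M) *m (e^T *m v^T) = v *m e *m (M *m (e^T *m v^T)).
    by rewrite !mulmxA.
  rewrite tr1 sqnormSE.
  have -> : e *m (M *m (e^T *m v^T)) *m S *m v =
     (e *m M *m e^T) *m (v^T *m S *m v) by rewrite !mulmxA.
  by rewrite mxE big_ord_recl big_ord0 addr0 mulrC.
by ring.
Qed.

Lemma addr_ge0_sqr (x z : R) : 0 <= z -> x ^+ 2 <= z ^+ 2 -> 0 <= x + z.
Proof. by move=> z0 xz; have [//|xz0] := leP 0 (x + z); nra. Qed.

(* [V] stands for the covariance of the nonlinear residual, [b y] for the
   [v]-component of [A y]: the new matrix replaces [b] by [- c u], with [c] such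
   that the total [S]-energy is preserved. *)
Lemma linear_improvement d n (S V : 'M[R]_d) (M K : 'M[R]_n) (X : 'M[R]_(n, d))
    (A : 'M[R]_(d, n)) : (0 < n)%N -> (0 < d)%N -> spd S -> spd M ->
  (forall N : 'M[R]_d, (forall x, 0 <= sqnormS N x) -> 0 <= \tr (N *m V)) ->
  exists B : 'M[R]_(d, n),
    \tr (S *m (B *m M *m B^T)) = \tr (S *m (A *m M *m A^T)) + \tr (S *m V) /\
    \tr ((X *m A - K) *m M *m (X *m A - K)^T) + \tr (X *m V *m X^T) <=
    \tr ((X *m B - K) *m M *m (X *m B - K)^T).
Proof.
move=> n0 d0 spS [sM pM] pV; have [sS pS] := spS.
have sW : (X^T *m X)^T = X^T *m X by rewrite trmx_mul trmxK.
have [v [l [Sv Wv Wle]]] := generalized_top_eigenpair d0 spS sW.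
pose m (x z : 'rV[R]_n) := (x *m M *m z^T) 0 0.
have mC x z : m x z = m z x.
  rewrite /m -[in RHS](trmxK (z *m M *m x^T)) [in RHS]mxE !trmx_mul trmxK sM.
  by rewrite mulmxA.
have mDl x x' z : m (x + x') z = m x z + m x' z.
  by rewrite /m !mulmxDl mxE.
have mZl c x z : m (c *: x) z = c * m x z.
  by rewrite /m -!scalemxAl mxE.
have mDr x z z' : m x (z + z') = m x z + m x z' by rewrite mC mDl !(mC x).
have mZr c x z : m x (c *: z) = c * m x z by rewrite mC mZl mC.
have mp x : x != 0 -> 0 < m x x.
  move=> x0; have := pM x^T; rewrite sqnormSE trmxK; apply.
  by apply: contra x0 => /eqP/(congr1 trmx); rewrite trmxK trmx0 => ->.
have m0 x : 0 <= m x x.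
  have [->|/mp/ltW//] := eqVneq x 0.
  by rewrite /m !mul0mx mxE.
have CS x z : m x z ^+ 2 <= m x x * m z z.
  have [->|z0] := eqVneq z 0.
    by rewrite /m trmx0 !mulmx0 mxE mulr0 expr0n.
  (* Expanding the form at this vector gives [m z z] times the Cauchy-Schwarz defect. *)
  have := m0 (m z z *: x + (- m x z) *: z).
  rewrite !(mDl, mDr, mZl, mZr) (mC z x) => H.
  have mz := mp z z0.
  rewrite -(ler_pM2l mz) -subr_ge0; apply: le_trans H _.
  by rewrite le_eqVlt; apply/orP; left; apply/eqP; ring.
(* [b] is the [v]-component of [A] in the [S] inner product; [ell] pairs [K] with the direction
   [X v]. *)
pose b := v^T *m S *m A; pose ell := v^T *m X^T *m K.
(* If [ell] vanishes there is no correlation to exploit, and any nonzero vector can carry the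
   energy. *)
have [u [u0 uell]] : exists u, u != 0 /\ (u = ell \/ ell = 0).
  have [->|ell0] := eqVneq ell 0; last by exists ell; split => //; left.
  exists (const_mx 1); split; last by right.
  case: (n) n0 => // n' _.
  by apply/eqP => /rowP/(_ 0); rewrite !mxE => /eqP; rewrite oner_eq0.
have mu := mp _ u0.
have tSV : 0 <= \tr (S *m V).
  apply: pV => x; have [->|/pS/ltW//] := eqVneq x 0.
  by rewrite sqnormSE mulmx0 mxE.
(* The energy to spend: that of the [v]-component plus that of the residual. The constant [c] makes
   [c u] carry exactly this amount. *)
pose rho := m b b + \tr (S *m V).
have rho0 : 0 <= rho by rewrite addr_ge0.
pose c := Num.sqrt (rho / m u u).
have c0 : 0 <= c by exact: sqrtr_ge0.
have c2 : c ^+ 2 * m u u = rho.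
  rewrite /c sqr_sqrtr; last exact: divr_ge0 rho0 (ltW mu).
  by rewrite divfK// lt0r_neq0.
(* As [rho >= m b b], Cauchy-Schwarz bounds |m b u| by [c * m u u]. *)
have cross0 : 0 <= m b ell + c * m u ell.
  case: uell => [ue|->]; last by rewrite /m trmx0 !mulmx0 !mxE mulr0 addr0.
  rewrite -ue; have y0 : 0 <= c * m u u by exact: mulr_ge0.
  have : m b u ^+ 2 <= (c * m u u) ^+ 2.
    have -> : (c * m u u) ^+ 2 = rho * m u u by rewrite -c2; ring.
    by apply: le_trans (CS b u) _; rewrite ler_wpM2r// lerDl.
  exact: addr_ge0_sqr.
(* Since [v] has unit [S]-norm, subtracting [v e] turns the component [b] into [- c u]. *)
pose e := b + c *: u.
exists (A - v *m e).
have SvE : A^T *m S *m v = b^T by rewrite /b !trmx_mul trmxK sS mulmxA.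
split.
  rewrite trace_rank1_update// Sv mul1r.
  have -> : e *m M *m A^T *m S *m v = e *m M *m b^T by rewrite -SvE !mulmxA.
  rewrite -[(e *m M *m b^T) 0 0]/(m e b) -[(e *m M *m e^T) 0 0]/(m e e).
  rewrite /e !(mDl, mDr, mZl, mZr) (mC u b).
  have -> : \tr (S *m V) = c ^+ 2 * m u u - m b b by rewrite c2 addrC addKr.
  by ring.
have -> : X *m (A - v *m e) - K = (X *m A - K) - (X *m v) *m e.
  by rewrite mulmxBr mulmxA addrAC.
have XvE : (X *m A - K)^T *m (X *m v) = (l *: b - ell)^T.
  rewrite !linearB/= mulmxBl trmxZ /ell /b !trmx_mul !trmxK sS.
  by rewrite -!mulmxA (mulmxA X^T) Wv -scalemxAr.
have Xv2 : sqnormS 1%:M (X *m v) = l.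
  rewrite sqnormSE mulmx1 trmx_mul -mulmxA (mulmxA X^T) Wv -scalemxAr mxE.
  by rewrite mulmxA -sqnormSE Sv mulr1.
have := trace_rank1_update (X *m A - K) (X *m v) e (trmx1 R n) sM.
rewrite !mul1mx => ->; rewrite Xv2.
rewrite mulmx1 -(mulmxA (e *m M)) XvE.
rewrite -[(e *m M *m e^T) 0 0]/(m e e).
rewrite -[(e *m M *m (l *: b - ell)^T) 0 0]/(m e (l *: b - ell)).
have -> : m e (l *: b - ell) = l * m e b - m e ell.
  by rewrite -scaleN1r mDr !mZr mulN1r.
(* Testing the nonnegative form of [l S - X^T X] against [V]: residual energy contributes no more
   training error than the same energy along [v]. *)
have tW : \tr (X *m V *m X^T) <= l * \tr (S *m V).
  have := pV (l *: S - X^T *m X).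
  rewrite mulmxBl linearB/= -scalemxAl linearZ/= subr_ge0 => H.
  rewrite mxtrace_mulC mulmxA; apply: H => x.
  by rewrite sqnormSB subr_ge0.
rewrite /e !(mDl, mDr, mZl, mZr) (mC u b).
rewrite -subr_ge0.
set tr0 := \tr (_ *m _ *m (X *m A - K)^T).
(* The gain splits into a Rayleigh term and a correlation term, both nonnegative. *)
have -> : tr0 - 2 * (l * (m b b + c * m b u) - (m b ell + c * m u ell)) +
    l * (m b b + c * m b u + (c * m b u + c * (c * m u u))) -
    (tr0 + \tr (X *m V *m X^T)) =
    (l * \tr (S *m V) - \tr (X *m V *m X^T)) + 2 * (m b ell + c * m u ell).
  have -> : \tr (S *m V) = c ^+ 2 * m u u - m b b by rewrite c2 addrC addKr.
  by ring.
by rewrite addr_ge0 ?subr_ge0// mulr_ge0.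
Qed.

End matrix_quadratics.

(** * Existence of a best linear matrix under a training constraint *)

Section linear_minimizer.
Context {R : realType} {d n : nat} (S : 'M[R]_d) (M : 'M[R]_n).
Hypotheses (n0 : (0 < n)%N) (d0 : (0 < d)%N) (spS : spd S) (spM : spd M).
Hypothesis pM : forall (B : 'M[R]_(d, n)) (N : 'M[R]_d),
  (forall x, 0 <= sqnormS N x) -> 0 <= \tr (N *m (B *m M *m B^T)).

(** Some l > 0 makes the form of [l S - 1] nonnegative, which reduces the claim to S = 1, where the
    trace is the sum of the [M]-energies of the rows of [B]. *)
Lemma mxtrace_quad_gt0 (B : 'M[R]_(d, n)) : B != 0 ->
  0 < \tr (S *m (B *m M *m B^T)).
Proof.
move=> B0; have [v [l [Sv _ Sle]]] := generalized_top_eigenpair d0 spS (trmx1 R d).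
have v0 : v != 0.
  apply/eqP => v0; move: Sv; rewrite v0 sqnormSE mulmx0 mxE => /esym/eqP.
  by rewrite oner_eq0.
have sq_gt0 : 0 < sqnormS 1%:M v.
  rewrite -sqnorm_sqnormS /sqnorm lt_neqAle eq_sym.
  rewrite sumr_ge0 ?andbT => [|i _]; last exact: sqr_ge0.
  apply: contra v0; rewrite psumr_eq0 => [/allP H|i _]; last exact: sqr_ge0.
  apply/eqP/colP => i; rewrite mxE; apply/eqP; rewrite -sqrf_eq0.
  exact: H i (mem_index_enum i).
have l0 : 0 < l by have := Sle v; rewrite Sv mulr1; exact: lt_le_trans.
rewrite -(pmulr_rgt0 _ l0).
have : 0 <= \tr ((l *: S - 1%:M) *m (B *m M *m B^T)).
  by apply: pM => x; rewrite sqnormSB subr_ge0.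
rewrite mulmxBl mul1mx -scalemxAl linearB/= linearZ/= subr_ge0.
apply: lt_le_trans; have rowE i : (B *m M *m B^T) i i = sqnormS M (row i B)^T.
  rewrite sqnormSE trmxK -row_mul !mxE; apply: eq_bigr => j _.
  by rewrite !mxE.
have [i Bi] : exists i, row i B != 0.
  apply/existsP; rewrite -negb_forall; apply: contra B0 => /forallP H.
  by apply/eqP/row_matrixP => i; rewrite row0; apply/eqP.
have spdM x : 0 <= sqnormS M x.
  have [->|/(spM.2 _)/ltW//] := eqVneq x 0.
  by rewrite sqnormSE mulmx0 mxE.
rewrite /mxtrace (bigD1 i)//=; apply: ltr_pwDl.
  rewrite rowE; apply: spM.2; apply: contra Bi => /eqP/(congr1 trmx).
  by rewrite trmxK trmx0 => ->.
by apply: sumr_ge0 => j _; rewrite rowE.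
Qed.

(** A continuous coercive function attains its minimum on a closed set; coercivity comes from
    maximizing |x|^2 / q'(x). *)
Lemma linear_minimizer (X : 'M[R]_(n, d)) (K : 'M[R]_n) (tau : R) :
  let t B := \tr ((X *m B - K) *m M *m (X *m B - K)^T) in
  let q B := \tr (S *m (B *m M *m B^T)) in
  (exists B, tau <= t B) ->
  exists B0, tau <= t B0 /\ forall B, tau <= t B -> q B0 <= q B.
Proof.
move=> t q [B1 tB1].
pose q' (x : 'rV[R]_(d * n)) := q (vec_mx x).
pose t' (x : 'rV[R]_(d * n)) := t (vec_mx x).
have cV := @contM_vec_mx R d n.
have cq : continuous q'.
  apply: continuous_mxtrace; apply: contM_mul; first exact: contM_cst.
  apply: contM_mul; last exact: contM_tr.
  by apply: contM_mul => //; exact: contM_cst.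
have ct : continuous t'.
  have cD : contM (fun x : 'rV[R]_(d * n) => X *m vec_mx x - K).
    apply: contM_sub; last exact: contM_cst.
    by apply: contM_mul => //; exact: contM_cst.
  apply: continuous_mxtrace; apply: contM_mul; last exact: contM_tr.
  by apply: contM_mul => //; exact: contM_cst.
have hq (r : R) x : q' (r *: x) = r ^+ 2 * q' x.
  rewrite /q' /q linearZ/= trmxZ -!scalemxAl -!scalemxAr scalerA linearZ/=.
  by rewrite expr2.
have pq x : x != 0 -> 0 < q' x.
  move=> x0; apply: mxtrace_quad_gt0; apply: contra x0 => /eqP vx.
  by rewrite -(vec_mxK x) vx linear0.
have cn : continuous (fun x : 'rV[R]_(d * n) => `|x| ^+ 2).
  under eq_fun do rewrite expr2.
  have cN : continuous (fun x : 'rV[R]_(d * n) => `|x|).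
    by move=> x; exact: norm_continuous.
  by move=> x; exact: cvgM (cN x) (cN x).
have hn (r : R) (x : 'rV[R]_(d * n)) : `|r *: x| ^+ 2 = r ^+ 2 * `|x| ^+ 2.
  by rewrite normrZ exprMn real_normK ?num_real.
have dn0 : (0 < d * n)%N by rewrite muln_gt0 d0.
have [x0 x00 ratio] := quadratic_ratio_max dn0 cn cq hn hq pq.
have qx0 := pq _ x00.
pose x1 := mxvec B1; pose r := `|x0| ^+ 2 * q' x1 / q' x0.
(* The search is cut at the level of the feasible [B1]; matrices above that level are worse than
   [B1]. *)
pose C := [set x | tau <= t' x] `&` [set x | q' x <= q' x1].
have Cx1 : C x1 by split => /=; rewrite /t' /x1 ?mxvecK.
have cC : compact C.
  apply: bounded_closed_compact.
    exists (r + 1); split; first exact: num_real.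
    move=> m rm x [_ /= qx].
    have le : `|x| ^+ 2 <= r.
      by rewrite ler_pdivlMr//; apply: le_trans (ratio x) _; rewrite ler_wpM2l// sqr_ge0.
    apply: le_trans (ltW rm); have := normr_ge0 x.
    by move: le; move: (`|x|) => z; nra.
  apply: closedI.
    apply: (@closed_comp _ _ t' [set z | tau <= z]); last exact: closed_ge.
    by move=> x _; exact: ct.
  apply: (@closed_comp _ _ q' [set z | z <= q' x1]); last exact: closed_le.
  by move=> x _; exact: cq.
have [x2 /[!inE] -[tx2 _] mx] := compact_EVT_min (ex_intro _ x1 Cx1) cC
  (continuous_subspaceT cq).
exists (vec_mx x2); split => // B tB.
have qE : q B = q' (mxvec B) by rewrite /q' mxvecK.
rewrite qE; have [qB|/ltW qB] := leP (q' (mxvec B)) (q' x1).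
  by apply: mx; rewrite inE; split => //=; rewrite /t' mxvecK.
by apply: le_trans qB; apply: mx; rewrite inE.
Qed.

End linear_minimizer.

(** * Prediction and training risks *)

Lemma sqnorm_ge0 (R : realType) m (v : 'cV[R]_m) : 0 <= sqnorm v.
Proof. by apply: sumr_ge0 => i _; exact: sqr_ge0. Qed.

Section risks.
Context {R : realType} {dT : measure_display} {T : measurableType dT}.
Context (P : probability T R) {n d : nat} (X : 'M[R]_(n, d)) (Sigma : 'M[R]_d).
Context (sigma : R) (theta : 'I_d -> T -> R) (w : 'I_n -> T -> R).
Hypotheses (n_gt0 : (0 < n)%N) (d_gt0 : (0 < d)%N).
Hypotheses (spSigma : spd Sigma) (sigma_gt0 : 0 < sigma).
Hypothesis model : gaussian_model P sigma theta w.

Let y := yV X theta w.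
Let M := cross P y y.
Let A0 := bayes X sigma.
Let K : 'M[R]_n := 1%:M - X *m A0.
Let ly : L2v P y := L2v_y X d_gt0 sigma_gt0 model.
Let lt : L2v P (thetaV theta) := L2v_theta d_gt0 sigma_gt0 model.
Let spM : spd M := cross_y_spd X d_gt0 sigma_gt0 model.

(** The risk of the posterior mean, an additive constant common to all estimators. *)
Let noise_risk := \tr (Sigma *m
  cross P (fun t => A0 *m y t - thetaV theta t) (fun t => A0 *m y t - thetaV theta t)).

Lemma L2vB m (F G : T -> 'cV[R]_m) : L2v P F -> L2v P G ->
  L2v P (fun t => F t - G t).
Proof.
move=> lF lG.
have -> : (fun t => F t - G t) = (fun t => F t + (- 1%:M) *m G t).
  by apply/funext => t; rewrite mulNmx mul1mx.
by apply: L2vD => //; exact: L2v_mulmx.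
Qed.

Lemma borel_mapP m k (f : 'cV[R]_m -> 'cV[R]_k) : borel_map f <->
  forall i, measurable_fun setT (fun v : cylT R m => f v i 0).
Proof.
split=> bf i; first by move=> _ B mB; rewrite setTI; exact: bf.
by move=> B mB; have := bf i measurableT B mB; rewrite setTI.
Qed.

Lemma borel_map_mulmx m k (B : 'M[R]_(k, m)) : borel_map (fun v => B *m v).
Proof.
apply/borel_mapP; apply: measurable_fun_mulmx => j.
exact: measurable_fun_coord.
Qed.

Lemma borel_mapB m k (f g : 'cV[R]_m -> 'cV[R]_k) :
  borel_map f -> borel_map g -> borel_map (fun v => f v - g v).
Proof.
move=> /borel_mapP bf /borel_mapP bg; apply/borel_mapP => i.
under eq_fun do rewrite !mxE.
exact: measurable_funB.
Qed.

Lemma H_sqP (f : 'cV[R]_n -> 'cV[R]_d) :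
  H_sq P X theta w f <-> borel_map f /\ L2v P (f \o y).
Proof.
split=> -[bf lf]; split => //.
  have mfy i : measurable_fun setT (fun t => f (y t) i 0).
    have := (borel_mapP f).1 bf i => mfi.
    apply: (measurableT_comp mfi); apply: measurable_fun_cylT => j.
    by case: (ly j).
  have js : P.-integrable setT (fun t => (sqnorm (f (y t)))%:E).
    apply/integrableP; split.
      apply/measurable_EFinP; apply: measurable_sum => i.
      exact: measurable_funX.
    under eq_integral do rewrite gee0_abs ?lee_fin ?sqnorm_ge0//.
    exact: lf.
  move=> i; apply: (L2_dominated _ js) => // t.
  by rewrite /sqnorm (bigD1 i)//= lerDl sumr_ge0// => j _; exact: sqr_ge0.
have -> : Ex P (fun t => sqnorm (f (y t))) = Ex P (fun t => sqnormS 1%:M (f (y t))).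
  by apply: eq_integral => t _; rewrite sqnorm_sqnormS.
by rewrite (Ex_sqnormS _ lf) ltry.
Qed.

(** Pythagoras: [f(y) - A0 y] is a function of [y], hence orthogonal to the Bayes error
    [A0 y - theta]. *)
Lemma Pred_bayes (f : 'cV[R]_n -> 'cV[R]_d) :
  borel_map f -> L2v P (f \o y) ->
  Pred P X Sigma theta w f =
  (\tr (Sigma *m cross P (fun t => f (y t) - A0 *m y t)
    (fun t => f (y t) - A0 *m y t)) + noise_risk)%:E.
Proof.
move=> bf lf; pose g v := f v - A0 *m v.
have bg : borel_map g by apply: borel_mapB => //; exact: borel_map_mulmx.
have lA : L2v P (fun t => A0 *m y t) by exact: L2v_mulmx.
have lg : L2v P (g \o y) by exact: L2vB lf lA.
have lr : L2v P (fun t => A0 *m y t - thetaV theta t) by exact: L2vB.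
have orth : cross P (fun t => A0 *m y t - thetaV theta t) (fun t => g (y t)) = 0.
  have -> : (fun t => A0 *m y t - thetaV theta t) =
      (fun t => A0 *m y t + (- 1%:M) *m thetaV theta t).
    by apply/funext => t; rewrite mulNmx mul1mx.
  rewrite cross_addl//; last exact: L2v_mulmx.
  rewrite !cross_mull//.
  rewrite [cross P (thetaV theta) _](cross_bayes d_gt0 sigma_gt0 model bg lg).
  by rewrite mulNmx mul1mx subrr.
have -> : Pred P X Sigma theta w f = Ex P (fun t => sqnormS Sigma
    (g (y t) + (A0 *m y t - thetaV theta t))).
  by apply: eq_integral => t _; rewrite /g addrA subrK.
rewrite Ex_sqnormS; last exact: L2vD.
have lgy : L2v P (fun t => g (y t)) := lg.
congr EFin; rewrite (cross_addl lgy lr (L2vD lgy lr)).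
rewrite (cross_addr lgy lgy lr) (cross_addr lr lgy lr) orth mulmxDr linearD/=.
by rewrite -[cross P _ (fun t => A0 *m y t - thetaV theta t)]crossC orth trmx0 addr0 add0r.
Qed.

(** A change of variable: X f(y) - y = X (f(y) - A0 y) - K y. *)
Lemma Train_bayes (f : 'cV[R]_n -> 'cV[R]_d) : L2v P (f \o y) ->
  Train P X theta w f = (n%:R^-1 * \tr (cross P
    (fun t => X *m (f (y t) - A0 *m y t) - K *m y t)
    (fun t => X *m (f (y t) - A0 *m y t) - K *m y t)))%:E.
Proof.
move=> lf; have lA : L2v P (fun t => A0 *m y t) by exact: L2v_mulmx.
rewrite /Train EFinM; congr (_ * _)%E.
have -> : Ex P (fun t => sqnorm (X *m f (y t) - y t)) =
    Ex P (fun t => sqnormS 1%:M (X *m (f (y t) - A0 *m y t) - K *m y t)).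
  apply: eq_integral => t _; rewrite -sqnorm_sqnormS; congr (sqnorm _)%:E.
  by rewrite /K mulmxBr mulmxBl mul1mx mulmxA opprB addrA subrK.
rewrite Ex_sqnormS ?mul1mx//.
by apply: L2vB; apply: L2v_mulmx => //; exact: L2vB.
Qed.

(** Orthogonality of [r] to [y] removes the mixed terms. *)
Lemma cross_residual m (E : 'M[R]_(m, n)) (C : 'M[R]_(m, d)) (r : T -> 'cV[R]_d) :
  L2v P r -> cross P r y = 0 ->
  cross P (fun t => E *m y t + C *m r t) (fun t => E *m y t + C *m r t) =
  E *m M *m E^T + C *m cross P r r *m C^T.
Proof.
move=> lr ry; have yr : cross P y r = 0 by rewrite -crossC ry trmx0.
have lE : L2v P (fun t => E *m y t) by exact: L2v_mulmx.
have lC : L2v P (fun t => C *m r t) by exact: L2v_mulmx.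
rewrite cross_addl//; last exact: L2vD.
rewrite !cross_addr// !cross_mull// !cross_mulr//.
by rewrite ry yr !mul0mx !mulmx0 addr0 add0r !mulmxA.
Qed.

Let q B := \tr (Sigma *m (B *m M *m B^T)).
Let tr B := \tr ((X *m B - K) *m M *m (X *m B - K)^T).

Let llin (B : 'M[R]_(d, n)) : L2v P (lin_est B \o y).
Proof. exact: L2v_mulmx. Qed.

(** The zero residual lets linear estimators be handled as the case [r = 0] of [cross_residual]. *)
Let l0 : L2v P (fun=> 0 : 'cV[R]_d).
Proof. by move=> i; under eq_fun do rewrite mxE; exact: (L2_cst P 0). Qed.

Let c0 : cross P (fun=> 0 : 'cV[R]_d) y = 0.
Proof.
by apply/matrixP => i j; rewrite !mxE; under eq_Rintegral do rewrite mxE mul0r;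
  rewrite Rintegral_cst// mul0r.
Qed.

Lemma Pred_lin (B : 'M[R]_(d, n)) :
  Pred P X Sigma theta w (lin_est (A0 + B)) = (q B + noise_risk)%:E.
Proof.
rewrite Pred_bayes//; last exact: borel_map_mulmx.
have -> : (fun t => lin_est (A0 + B) (y t) - A0 *m y t) =
    (fun t => B *m y t + (0 : 'M[R]_d) *m 0).
  by apply/funext => t; rewrite /lin_est mulmxDl addrC addKr mul0mx addr0.
by rewrite cross_residual// !mul0mx addr0.
Qed.

Lemma Train_lin (B : 'M[R]_(d, n)) :
  Train P X theta w (lin_est (A0 + B)) = (n%:R^-1 * tr B)%:E.
Proof.
rewrite Train_bayes//.
have -> : (fun t => X *m (lin_est (A0 + B) (y t) - A0 *m y t) - K *m y t) =
    (fun t => (X *m B - K) *m y t + (0 : 'M[R]_(n, d)) *m 0).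
  apply/funext => t; rewrite /lin_est mul0mx addr0 [in RHS]mulmxBl -(mulmxA X B).
  by congr (_ *m _ - _); rewrite mulmxDl addrC addKr.
by rewrite cross_residual// !mul0mx addr0.
Qed.

(** Both risks depend on [f] only through [A1] and the moment matrix [V] of the residual, which are
    the data of [linear_improvement]. *)
Lemma linear_dominates (f : 'cV[R]_n -> 'cV[R]_d) : H_sq P X theta w f ->
  exists A : 'M[R]_(d, n),
    (Pred P X Sigma theta w (lin_est A) <= Pred P X Sigma theta w f)%E /\
    (Train P X theta w f <= Train P X theta w (lin_est A))%E.
Proof.
move=> /H_sqP[bf lf].
pose del t := f (y t) - A0 *m y t.
have ld : L2v P del by apply: L2vB => //; exact: L2v_mulmx.
have uM : M \in unitmx.
  rewrite -row_free_unit -kermx_eq0; apply/rowV0P => u /sub_kermxP uM.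
  apply/eqP; apply: contraT => u0; have := spM.2 u^T.
  rewrite sqnormSE trmxK uM mul0mx mxE ltxx; apply.
  by apply: contra u0 => /eqP/(congr1 trmx); rewrite trmxK trmx0 => ->.
(* The solution of the normal equations, so that the residual [r] is orthogonal to [y]. *)
pose A1 := cross P del y *m invmx M.
pose r t := del t - A1 *m y t.
have lr : L2v P r by apply: L2vB => //; exact: L2v_mulmx.
have ry : cross P r y = 0.
  have -> : r = (fun t => del t + (- A1) *m y t).
    by apply/funext => t; rewrite mulNmx.
  rewrite cross_addl//; last exact: L2v_mulmx.
  by rewrite cross_mull// mulNmx mulmxKV// subrr.
pose V := cross P r r.
have [|B [qB tB]] := linear_improvement K X A1 n_gt0 d_gt0 spSigma spM (V := V).
  by move=> N pN; exact: cross_psd.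
exists (A0 + B); rewrite Pred_lin Train_lin Pred_bayes// Train_bayes//.
have -> : (fun t => f (y t) - A0 *m y t) = (fun t => A1 *m y t + 1%:M *m r t).
  by apply/funext => t; rewrite mul1mx /r [RHS]addrC subrK.
have -> : (fun t => X *m (f (y t) - A0 *m y t) - K *m y t) =
    (fun t => (X *m A1 - K) *m y t + X *m r t).
  apply/funext => t; rewrite (mulmxBl (X *m A1) K) -(mulmxA X A1).
  rewrite [RHS]addrC addrA.
  by rewrite -mulmxDr /r subrK.
have trD p (C D : 'M[R]_p) : \tr (C + D) = \tr C + \tr D by exact: linearD.
rewrite !cross_residual// -/V mul1mx trmx1 mulmx1 mulmxDr !trD.
by rewrite !lee_fin -qB lexx ler_pM2l ?invr_gt0 ?ltr0n.
Qed.

(** Writing A = A0 + B leaves the problem of minimizing [q] under a lower bound on [tr]. *)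
Lemma linear_optimum (eps : R) :
  (exists A, ((eps ^+ 2)%:E <= Train P X theta w (lin_est A))%E) ->
  exists A : 'M[R]_(d, n), ((eps ^+ 2)%:E <= Train P X theta w (lin_est A))%E /\
    forall A', ((eps ^+ 2)%:E <= Train P X theta w (lin_est A'))%E ->
    (Pred P X Sigma theta w (lin_est A) <= Pred P X Sigma theta w (lin_est A'))%E.
Proof.
have AE (A : 'M[R]_(d, n)) : A = A0 + (A - A0) by rewrite addrC subrK.
have trE B : ((eps ^+ 2)%:E <= (n%:R^-1 * tr B)%:E)%E = (n%:R * eps ^+ 2 <= tr B).
  by rewrite lee_fin mulrC ler_pdivlMr ?ltr0n// mulrC.
have pM (B : 'M[R]_(d, n)) (N : 'M[R]_d) :
    (forall x, 0 <= sqnormS N x) -> 0 <= \tr (N *m (B *m M *m B^T)).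
  move=> pN; have lB : L2v P (fun t => B *m y t) by exact: L2v_mulmx.
  have -> : B *m M *m B^T = cross P (fun t => B *m y t) (fun t => B *m y t).
    by rewrite cross_mull// cross_mulr// mulmxA.
  exact: cross_psd.
move=> [A HA]; rewrite (AE A) Train_lin trE in HA.
have [B [tB mB]] := linear_minimizer n_gt0 d_gt0 spSigma spM pM
  (ex_intro _ (A - A0) HA).
exists (A0 + B); rewrite Train_lin trE; split=> // A'.
rewrite (AE A') Train_lin trE !Pred_lin lee_fin lerD2r.
exact: mB.
Qed.

End risks.

(** * Equality of the infima and attainment by a linear estimator *)

Unset Implicit Arguments.

(** The minimum is rendered as an equality of infima together with attainment as soon as some linear
    estimator is feasible; if none is, both infima range over empty sets. *)
Theorem theorem4 (R : realType) (dT : measure_display) (T : measurableType dT)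
  (P : probability T R) (n d : nat) (X : 'M[R]_(n, d)) (Sigma : 'M[R]_d)
  (sigma : R) (theta : 'I_d -> T -> R) (w : 'I_n -> T -> R) (eps : R) :
  (0 < n)%N -> (n <= d)%N -> spd Sigma -> 0 < sigma ->
  gaussian_model P sigma theta w ->
  0 <= eps ->
  let Pr := Pred P X Sigma theta w in
  let Tr := Train P X theta w in
  ereal_inf (Pr @` restrict_train P X theta w (H_sq P X theta w) eps)
  = ereal_inf [set Pr (lin_est A) | A in [set A | ((eps ^+ 2)%:E <= Tr (lin_est A))%E]]
  /\ ((exists A, ((eps ^+ 2)%:E <= Tr (lin_est A))%E) ->
      exists A0 : 'M[R]_(d, n), ((eps ^+ 2)%:E <= Tr (lin_est A0))%E /\
        forall A, ((eps ^+ 2)%:E <= Tr (lin_est A))%E ->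
          (Pr (lin_est A0) <= Pr (lin_est A))%E).
Proof.
move=> n0 nd spS s0 model _ Pr Tr; have d0 := leq_trans n0 nd.
split; last exact: (linear_optimum n0 d0 spS s0 model).
apply/eqP; rewrite eq_le; apply/andP; split.
  (* Linear estimators belong to the square-integrable class. *)
  apply: ereal_inf_le_tmp => _ [A /= trA <-]; exists (lin_est A) => //; split => //.
  apply/(H_sqP X d0 s0 model); split; first exact: borel_map_mulmx.
  by apply: L2v_mulmx; exact: L2v_y d0 s0 model.
(* Every competitor is dominated by a linear estimator of no smaller training error, hence still
   feasible. *)
apply: le_ereal_inf_tmp => _ [f [Hf trf] <-].
have [A [PA TA]] := linear_dominates n0 d0 spS s0 model Hf.
apply: le_trans PA; apply: ereal_inf_lbound; exists A => //=.
exact: le_trans trf TA.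
Qed.
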